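(* Let $(k_n)_{n\ge1}$ be an arbitrary sequence of positive integers. Then, as $n\to\infty$, $$\mathbb{E}\big[\mathcal{L}_{\le}(S_{k_n;n})\big]=2\sqrt{nk_n}+k_n+o(\sqrt{nk_n}).$$
   Context: A $k$-multiset permutation of size $n$ is a word $s=(s(1),\dots,s(kn))$ with letters in $\{1,\dots,n\}$ in which each letter appears exactly $k$ times; it is identified with the point set $\{(i,s(i)):1\le i\le kn\}\subset[0,\infty)^2$. $S_{k;n}$ denotes a $k$-multiset permutation of size $n$ chosen uniformly at random. On $[0,\infty)^2$ define the partial order $(x,y)\preccurlyeq(x',y')$ iff $x<x'$ and $y\le y'$. For a finite set $\mathcal P\subset[0,\infty)^2$, $\mathcal L_\le(\mathcal P)$ is the largest $L$ such that there exist $P_1\preccurlyeq P_2\preccurlyeq\dots\preccurlyeq P_L$ in $\mathcal P$ (the length of a longest non-decreasing subsequence). *)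

(* Defs.v *)
From HB Require Import structures.
From mathcomp Require Import all_boot all_order all_algebra.
From mathcomp Require Import all_classical all_reals.
From mathcomp Require Import topology normedtype sequences.
Set Implicit Arguments. Unset Strict Implicit. Unset Printing Implicit Defensive.
Import Order.TTheory GRing.Theory Num.Theory.

Definition LNDS (n : nat) (s : seq 'I_n) : nat :=
  \max_(m : (size s).-tuple bool)
     (if sorted (fun a b : 'I_n => (a <= b)%N) (mask m s)
      then size (mask m s) else 0%N).

(* k-multiset permutations of size n: words of length k*n over the alphabet
   'I_n = {0,...,n-1} (standing for {1,...,n}) in which every letter occurs
   exactly k times. *)
Definition multiset_perms (k n : nat) : {set (k * n).-tuple 'I_n} :=
  [set w : (k * n).-tuple 'I_n | [forall i : 'I_n, count_mem i w == k]].

Definition expected_LNDS (R : realType) (k n : nat) : R :=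
  (\sum_(w in multiset_perms k n) (LNDS w)%:R) / #|multiset_perms k n|%:R.

(* Main.v *)
Require Import Defs.
From HB Require Import structures.
From mathcomp Require Import all_boot all_order all_algebra.
From mathcomp Require Import all_classical all_reals.
From mathcomp Require Import topology normedtype sequences exp.
From mathcomp Require Import zify ring lra.
Set Implicit Arguments. Unset Strict Implicit. Unset Printing Implicit Defensive.
Import Order.TTheory GRing.Theory Num.Theory.

(** Stationary Hammersley process, in discrete time.  Read a random word from
    left to right and add "sources" (extra smallest letters, [alpha] times as
    frequent as an ordinary letter) and "sinks" (an initial sorted block with
    independent geometric multiplicities of ratio [1 / alpha]).  The first row
    of the insertion tableau is then stationary, so with [k] points in each of
    [n] rows the longest path has mean [alpha k + n / (alpha - 1)], with small
    variance.  Its minimum over [alpha], reached at [alpha = 1 + sqrt (n / k)],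
    is [k + 2 sqrt (n k)], which gives the upper bound.  Slightly above the
    optimal [alpha] the path leaves the axes through the sources, so the sinks
    can be dropped; and the mean length is convex in the source intensity, with
    almost zero slope near the optimum.  Extrapolating down to [alpha = 1],
    where sources are just one more row, gives the matching lower bound.

    To pass from independent letters to exactly [k] copies of each letter, the
    word is made slightly longer or shorter and the counts are compared by a
    Chernoff bound, which works when [k] is at least a constant times [n].
    Otherwise, merging consecutive letters only lengthens non-decreasing
    subsequences, and reduces the upper bound to the previous case and the
    lower bound to ordinary permutations. *)

(** * Longest non-decreasing subsequences and the row-insertion chain *)

(** The stationary mean [alpha k + n / (alpha - 1)] has a pole at [alpha = 1], where the sources
    become an ordinary row; this is why that case is reached only by extrapolation from intensities
    near the optimum. At relative distance [d] above the optimum the stationary mean exceeds its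
    minimum by a gap of order [d^2 s], where [s = sqrt (n k)], while the variances are of order
    [k + s]. For fixed [d] their ratio to the squared gap is of order [1 / n + 1 / s], so second
    moments suffice. Extrapolation divides the errors by [d], hence [d] is fixed before the sizes
    grow. Blank letters play the part of the empty columns of a Poisson model: they make the
    intensities of sources and rows independent parameters. The geometric laws are truncated so that
    every law is a finite list; stationarity then holds up to an error exponentially small in the
    truncation level, which beats the affine growth of the Lipschitz constants. *)

Fixpoint lnd (a : nat) (w : seq nat) : nat :=
  if w is x :: w' then
    if a <= x then maxn (lnd a w') (lnd x w').+1 else lnd a w'
  else 0.

(** [lnd a w] measures the non-decreasing subsequences of [w] with all letters at least [a]; the
    threshold rises to [x] once [x] is kept. A lower threshold admits more of them. *)
Lemma lnd_anti a b w : a <= b -> lnd b w <= lnd a w.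
Proof.
move=> ab; elim: w => //= x w IH.
case: (leqP b x) => bx; case: (leqP a x) => ax; try lia.
Qed.

Lemma lnd_size a w : lnd a w <= size w.
Proof.
elim: w a => //= x w IH a; have := IH a; have := IH x; case: ifP; lia.
Qed.

Lemma lnd_head a w : lnd a (a :: w) = (lnd a w).+1.
Proof. by rewrite /= leqnn; lia. Qed.

Lemma lnd_insert a u x v :
  lnd a (u ++ v) <= lnd a (u ++ x :: v) <= (lnd a (u ++ v)).+1.
Proof.
elim: u a => [|y u IH] a /=; last first.
  by have := IH a; have := IH y; case: ifP; lia.
case: ifP => [ax|_]; last lia.
have := lnd_anti v ax; lia.
Qed.

Lemma lnd_map (f : nat -> nat) a b w : (forall x y, x <= y -> f x <= f y) ->
  (forall x, a <= x -> b <= f x) -> lnd a w <= lnd b (map f w).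
Proof.
move=> fm; elim: w a b => //= x w IH a b ab.
have h1 := IH a b ab; have h2 := IH x (f x) (fm x).
case: (leqP a x) => [ax|_]; last by case: ifP; lia.
rewrite (ab _ ax); lia.
Qed.

Lemma lnd_map_mono (f : nat -> nat) a b w : {mono f : x y / x <= y} ->
  (forall x, (b <= f x) = (a <= x)) -> lnd b (map f w) = lnd a w.
Proof.
move=> fm; elim: w a b => //= x w IH a b ab.
by rewrite ab (IH _ _ ab) (IH x (f x)) ?fm.
Qed.

Lemma lnd_path a w u : subseq u w -> path leq a u -> size u <= lnd a w.
Proof.
elim: w a u => [|x w IH] a u /=; first by move/eqP->.
case: u => [|y u] //= s /andP[ay p].
move: s; case: eqP => [e|_] s.
  by subst y; rewrite ay leq_max ltnS (IH _ _ s p) orbT.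
have /= := IH a (y :: u) s; rewrite ay p => /(_ isT).
by case: ifP; lia.
Qed.

Lemma lnd_path_witness a w :
  exists u, [/\ subseq u w, path leq a u & size u = lnd a w].
Proof.
elim: w a => [|x w IH] a; first by exists [::].
have [u [su pu zu]] := IH a; have [v [sv pv zv]] := IH x => /=.
have skip : exists u, [/\ subseq u (x :: w), path leq a u & size u = lnd a w].
  by exists u; split=> //; apply: subseq_trans su (subseq_cons _ _).
case: (leqP a x) => // ax.
case: (leqP (lnd x w).+1 (lnd a w)) => h; first by [].
exists (x :: v).
by split; rewrite /= ?eqxx ?ax ?zv.
Qed.

Lemma LNDS_lnd n (s : seq 'I_n) : LNDS s = lnd 0 (map val s).
Proof.
have path0 (u : seq nat) : sorted leq u = path leq 0 u by case: u.
apply/eqP; rewrite eqn_leq; apply/andP; split.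
  apply/bigmax_leqP => m _; case: ifP => // so.
  rewrite -(size_map val); apply: lnd_path.
    by rewrite map_mask; apply: mask_subseq.
  by rewrite -path0 sorted_map.
have [u [/subseqP [m sm um] pu <-]] := lnd_path_witness 0 (map val s).
have szm : size m == size s by rewrite sm size_map.
apply: leq_trans (leq_bigmax (Tuple szm)) => /=.
rewrite -path0 um -map_mask sorted_map in pu.
by rewrite pu um -map_mask size_map.
Qed.

(* [profile a c w] is the maximum over [j] of [c_a + ... + c_j + lnd j w]. *)
Fixpoint profile (a : nat) (c : seq nat) (w : seq nat) : nat :=
  if c is m :: r then m + maxn (lnd a w) (profile a.+1 r w) else 0.

(** Here [c] lists the multiplicities of the letters in the first row of a tableau. [bump] removes
    the smallest letter, if any; [ins j] is Schensted insertion, where [j] displaces the smallest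
    strictly larger letter. *)
Fixpoint bump (c : seq nat) : seq nat :=
  if c is m :: r then (if m is m'.+1 then m' :: r else 0 :: bump r) else [::].

Fixpoint ins (j : nat) (c : seq nat) {struct c} : seq nat :=
  if c is m :: r then (if j is j'.+1 then m :: ins j' r else m.+1 :: bump r)
  else [::].

Lemma size_bump c : size (bump c) = size c.
Proof. by elim: c => //= -[|m] r /= IH; rewrite ?IH. Qed.

Lemma size_ins j c : size (ins j c) = size c.
Proof. by elim: c j => //= m r IH [|j] /=; rewrite ?size_bump ?IH. Qed.

Lemma profile_nil a c : profile a c [::] = sumn c.
Proof. by elim: c a => //= m r IH a; rewrite IH max0n. Qed.

Lemma profile_cons_lt a c x w : x < a -> profile a c (x :: w) = profile a c w.
Proof.
elim: c a => //= m r IH a xa; rewrite IH; last lia.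
by rewrite leqNgt xa.
Qed.

(** Before the first nonzero entry the partial sums vanish and the terms are absorbed by [g]; from
    that entry on, bumping lowers every partial sum by one. *)
Lemma profile_bump a c w g : lnd a w <= g ->
  maxn g.+1 (profile a c w) = (maxn g (profile a (bump c) w)).+1.
Proof.
elim: c a g => [|m r IH] a g hg /=; first lia.
case: m => [|m] /=; last lia.
have h1 : lnd a.+1 w <= g by apply: leq_trans hg; apply: lnd_anti.
by have := IH _ _ h1; lia.
Qed.

Lemma profile_ins_ge a j c w : j < size c ->
  lnd (a + j) w < profile a (ins j c) w.
Proof.
elim: c a j => // m r IH a [|j] /= hj; first by rewrite addn0; lia.
by have := IH a.+1 j hj; rewrite addSnnS; lia.
Qed.

(** A path through the leading letter is best entered at index [j], where it contributes the partial
    sum up to [j] plus [1 + lnd (a + j) w]. Raising the multiplicity of [j] produces this term, and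
    the bump cancels the rise in all later terms that it does not dominate. *)
Lemma profile_cons a j c w : j < size c ->
  profile a c ((a + j) :: w) = profile a (ins j c) w.
Proof.
elim: c a j => // m r IH a [|j] /= hj.
  rewrite addn0 leqnn profile_cons_lt //.
  have := @profile_bump a.+1 r w (lnd a w) (lnd_anti _ (leqnSn a)).
  lia.
rewrite leq_addr -addSnnS IH //.
have := @profile_ins_ge a.+1 j r w hj.
lia.
Qed.

Lemma profile_le a c w : profile a c w <= sumn c + lnd a w.
Proof.
elim: c a => //= m r IH a; have := IH a.+1.
have := lnd_anti w (leqnSn a); lia.
Qed.

(* Letters [0] are blanks, letters [1] are sources, and letter [j.+2] belongs
   to row [j]. *)
Definition step (x : nat) (c : seq nat) : seq nat :=
  if x is x'.+1 then (if x' is j.+1 then ins j c else bump c) else c.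

Fixpoint run (w : seq nat) (c : seq nat) : seq nat :=
  if w is x :: w' then run w' (step x c) else c.

(** Sources are smaller than every row letter, so a path that starts with sinks can use no source:
    the two arguments are the paths without sinks and the paths from the sink block. *)
Definition Lam (c w : seq nat) : nat := maxn (lnd 1 w) (profile 2 c w).

Lemma Lam_run c w : all (fun x => x < (size c).+2) w ->
  Lam c w = count_mem 1 w + sumn (run w c).
Proof.
(* The source letter is carried as an extra first entry [m]: nothing smaller can bump it, so it only
   counts sources. The case [m = 0] is [Lam]. *)
suff H m : all (fun x => x < (size c).+2) w ->
    profile 1 (m :: c) w = m + (count_mem 1 w + sumn (run w c)).
  by move=> /(H 0).
elim: w c m => [|x w IH] c m.
  by rewrite profile_nil.
case/andP => hx hw; case: x hx => [|[|j]] hx.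
- by rewrite profile_cons_lt // IH //= add0n.
- rewrite (@profile_cons 1 0 (m :: c) w) // [ins _ _]/= IH ?size_bump //=.
  lia.
- rewrite (@profile_cons 1 j.+1 (m :: c) w) // [ins _ _]/= IH ?size_ins //=.
Qed.

(** * Expectations over random words *)

Local Open Scope ring_scope.

Section Expectation.
Variable R : realType.

(** Laws are finite lists of weighted outcomes, and [EW mu T] averages over [T] independent draws,
    so probability reduces to finite sums and induction on [T]. *)
Definition E1 (X : Type) (mu : seq (R * X)) (f : X -> R) : R :=
  \sum_(a <- mu) a.1 * f a.2.

Fixpoint EW (X : Type) (mu : seq (R * X)) (T : nat) (F : seq X -> R) : R :=
  if T is T'.+1 then E1 mu (fun x => EW mu T' (fun w => F (x :: w)))
  else F [::].

Definition law (X : Type) (mu : seq (R * X)) : Prop :=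
  all (fun a => 0 <= a.1) mu /\ E1 mu (fun _ => 1) = 1.

Section Generic.
Variables (X : Type) (mu : seq (R * X)).
Implicit Types (f g : X -> R) (F G : seq X -> R) (P : pred X).

Lemma E1_ext P f g : all (fun a => P a.2) mu ->
  (forall x, P x -> f x = g x) -> E1 mu f = E1 mu g.
Proof.
rewrite /E1 => hP h; elim: mu hP => [|a m IH] /=; first by rewrite !big_nil.
by case/andP=> /h ha /IH; rewrite !big_cons ha => ->.
Qed.

Lemma E1_eq f g : f =1 g -> E1 mu f = E1 mu g.
Proof. by move=> h; apply: eq_bigr => a _; rewrite h. Qed.

Lemma E1D f g : E1 mu (fun x => f x + g x) = E1 mu f + E1 mu g.
Proof. by rewrite /E1 -big_split; apply: eq_bigr => a _; rewrite mulrDr. Qed.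

Lemma E1Z c f : E1 mu (fun x => c * f x) = c * E1 mu f.
Proof. by rewrite /E1 mulr_sumr; apply: eq_bigr => a _; rewrite mulrCA. Qed.

Lemma E1_sum I (r : seq I) (f : I -> X -> R) :
  E1 mu (fun x => \sum_(i <- r) f i x) = \sum_(i <- r) E1 mu (f i).
Proof.
rewrite /E1 exchange_big /=; apply: eq_bigr => a _.
by rewrite mulr_sumr.
Qed.

Hypothesis lmu : law mu.

Lemma E1_le P f g : all (fun a => P a.2) mu ->
  (forall x, P x -> f x <= g x) -> E1 mu f <= E1 mu g.
Proof.
case: lmu => [hpos _] hP h; rewrite /E1.
elim: mu hP hpos => [|a m IH] /=; first by rewrite !big_nil.
case/andP=> /h ha /IH{}IH /andP[a0 /IH{}IH]; rewrite !big_cons.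
by apply: lerD => //; apply: ler_wpM2l.
Qed.

Lemma E1_cst c : E1 mu (fun _ => c) = c.
Proof.
by rewrite -[RHS]mulr1 -lmu.2 -E1Z; apply: E1_eq => x; rewrite mulr1.
Qed.

End Generic.

Section Words.
Variables (X : Type) (mu : seq (R * X)).
Implicit Types (F G : seq X -> R) (P : pred X) (T : nat).

Lemma EW_ext P T F G : all (fun a => P a.2) mu ->
  (forall w, size w = T -> all P w -> F w = G w) -> EW mu T F = EW mu T G.
Proof.
move=> hP; elim: T F G => [|T IH] F G h /=; first exact: h.
apply: (E1_ext hP) => x Px; apply: IH => w sw Pw.
by apply: h => /=; rewrite ?sw ?Px.
Qed.

Lemma EW_eq T F G : F =1 G -> EW mu T F = EW mu T G.
Proof.
move=> h; apply: (@EW_ext xpredT) => //; by elim: mu.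
Qed.

Lemma EWD T F G : EW mu T (fun w => F w + G w) = EW mu T F + EW mu T G.
Proof.
elim: T F G => [|T IH] F G //=; rewrite -E1D; apply: E1_eq => x.
by rewrite -IH.
Qed.

Lemma EWZ T c F : EW mu T (fun w => c * F w) = c * EW mu T F.
Proof.
elim: T F => [|T IH] F //=; rewrite -E1Z; apply: E1_eq => x.
by rewrite -IH.
Qed.

Lemma EWN T F : EW mu T (fun w => - F w) = - EW mu T F.
Proof.
rewrite -mulN1r -EWZ; apply: EW_eq => w; by rewrite mulN1r.
Qed.

Lemma EWB T F G : EW mu T (fun w => F w - G w) = EW mu T F - EW mu T G.
Proof. by rewrite EWD EWN. Qed.

Lemma EW_sum T I (r : seq I) (F : I -> seq X -> R) :
  EW mu T (fun x => \sum_(i <- r) F i x) = \sum_(i <- r) EW mu T (F i).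
Proof.
elim: T F => [|T IH] F //=; rewrite -E1_sum; apply: E1_eq => x.
by rewrite IH.
Qed.

Lemma EW_E1 T Y (nu : seq (R * Y)) (F : Y -> seq X -> R) :
  EW mu T (fun w => E1 nu (fun y => F y w)) = E1 nu (fun y => EW mu T (F y)).
Proof. by rewrite /E1 EW_sum; apply: eq_bigr => a _; rewrite EWZ. Qed.

Lemma EW_map Y (g : X -> Y) T (F : seq Y -> R) :
  EW mu T (fun w => F (map g w)) = EW [seq (a.1, g a.2) | a <- mu] T F.
Proof.
elim: T F => [|T IH] F //=; rewrite /E1 big_map.
by apply: eq_bigr => a _ /=; rewrite -IH.
Qed.

Lemma EW_prod T (f : X -> R) :
  EW mu T (fun w => \prod_(x <- w) f x) = E1 mu f ^+ T.
Proof.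
elim: T => [|T IH] /=; first by rewrite big_nil.
rewrite exprSr -IH -E1Z; apply: E1_eq => x.
by rewrite mulrC -EWZ; apply: EW_eq => w; rewrite big_cons.
Qed.

Hypothesis lmu : law mu.

Lemma EW_cst T c : EW mu T (fun _ => c) = c.
Proof. by elim: T => //= T IH; rewrite IH E1_cst. Qed.

Lemma EW_le_in P T F G : all (fun a => P a.2) mu ->
  (forall w, size w = T -> all P w -> F w <= G w) -> EW mu T F <= EW mu T G.
Proof.
move=> hP; elim: T F G => [|T IH] F G h /=; first exact: h.
apply: (E1_le lmu hP) => x Px; apply: IH => w sw Pw.
by apply: h => /=; rewrite ?sw ?Px.
Qed.

Lemma EW_le T F G : (forall w, F w <= G w) -> EW mu T F <= EW mu T G.
Proof. by move=> h; apply: (@EW_le_in xpredT) => //; elim: mu. Qed.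

Lemma EW_mean T (f : X -> R) :
  EW mu T (fun w => \sum_(x <- w) f x) = T%:R * E1 mu f.
Proof.
elim: T => [|T IH] /=; first by rewrite big_nil mul0r.
under E1_eq => x do under EW_eq => w do rewrite big_cons.
under E1_eq => x do rewrite EWD EW_cst IH.
by rewrite E1D E1_cst // -natr1 mulrDl mul1r addrC.
Qed.

Lemma EW_var T (f : X -> R) (m : R) : E1 mu f = m ->
  EW mu T (fun w => (\sum_(x <- w) f x - T%:R * m) ^+ 2) =
  T%:R * E1 mu (fun x => (f x - m) ^+ 2).
Proof.
move=> fm; elim: T => [|T IH] /=.
  by rewrite big_nil !mul0r subrr expr0n.
under E1_eq => x do under EW_eq => w do
  (rewrite big_cons (_ : _ ^+ 2 = (f x - m) ^+ 2 + ((2 * (f x - m)) *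
     (\sum_(x <- w) f x - T%:R * m) + (\sum_(x <- w) f x - T%:R * m) ^+ 2));
   last by rewrite -natr1; ring).
under E1_eq => x do rewrite EWD EW_cst EWD IH EWZ EWB EW_cst EW_mean fm subrr
  mulr0 add0r.
by rewrite E1D E1_cst // -natr1; ring.
Qed.

End Words.
End Expectation.

(** * Truncated geometric laws *)

Section Geometric.
Variable R : realType.
Implicit Types (p : R) (M n : nat).

(* The law of [minn G M] for a geometric variable [G] with [P (G >= m) = p ^+ m]. *)
Fixpoint geo p M : seq (R * nat) :=
  if M is M'.+1 then (1 - p, 0%N) :: [seq (p * a.1, a.2.+1) | a <- geo p M']
  else [:: (1, 0%N)].

Lemma E1_geo0 p f : E1 (geo p 0) f = f 0%N.
Proof. by rewrite /E1 big_seq1 mul1r. Qed.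

Lemma E1_geoS p M f :
  E1 (geo p M.+1) f = (1 - p) * f 0%N + p * E1 (geo p M) (fun m => f m.+1).
Proof.
rewrite /E1 big_cons big_map mulr_sumr /=; congr (_ + _).
by apply: eq_bigr => a _; rewrite mulrA.
Qed.

(** The two truncations differ only in where they put the mass [p ^+ M.+1] of the event that the
    variable exceeds [M]. *)
Lemma E1_geo_shift p M f :
  E1 (geo p M.+1) f - E1 (geo p M) f = p ^+ M.+1 * (f M.+1 - f M).
Proof.
elim: M f => [|M IH] f.
  by rewrite E1_geoS !E1_geo0 expr1; ring.
rewrite [E1 (geo p M.+2) f]E1_geoS [E1 (geo p M.+1) f]E1_geoS exprS -mulrA.
by rewrite -(IH (fun m => f m.+1)); ring.
Qed.

Lemma geo_law p M : 0 <= p <= 1 -> law (geo p M).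
Proof.
move=> /andP[p0 p1]; split; last first.
  elim: M => [|M IH]; first by rewrite E1_geo0.
  by rewrite E1_geoS IH; ring.
elim: M => [|M IH] /=; first by rewrite ler01.
rewrite subr_ge0 p1 all_map; apply: sub_all IH => a /= ha.
exact: mulr_ge0.
Qed.

Lemma geo_supp p M : all (fun a => (a.2 <= M)%N) (geo p M).
Proof. by elim: M => //= M IH; rewrite all_map. Qed.

Lemma E1_geo_le p p' M f : 0 <= p -> p <= p' -> p' <= 1 ->
  (forall m, f m <= f m.+1) -> E1 (geo p M) f <= E1 (geo p' M) f.
Proof.
move=> p0 pp p1; elim: M f => [|M IH] f fm; first by rewrite !E1_geo0.
rewrite !E1_geoS.
have h : f 0%N <= E1 (geo p' M) (fun m => f m.+1).
  have lp : law (geo p' M) by apply: geo_law; lra.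
  rewrite -(E1_cst lp (f 0%N)).
  apply: (E1_le lp (P := xpredT)) => [|m _]; first by elim: (geo p' M).
  by elim: m => // m; move=> /le_trans; apply.
have := ler_wpM2l p0 (IH (fun m => f m.+1) (fun m => fm m.+1)).
have := mulr_ge0 (_ : 0 <= p' - p) (_ : 0 <= E1 (geo p' M) (fun m => f m.+1) - f 0%N).
rewrite !subr_ge0 => /(_ pp h); nra.
Qed.

Lemma EW_geo_le p p' M n F : 0 <= p -> p <= p' -> p' <= 1 ->
  (forall c c', all2 leq c c' -> F c <= F c') ->
  EW (geo p M) n F <= EW (geo p' M) n F.
Proof.
move=> p0 pp p1; have lp : law (geo p M) by apply: geo_law; lra.
have lp' : law (geo p' M) by apply: geo_law; lra.
elim: n F => [|n IH] F Fm /=; first exact: Fm.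
apply: (@le_trans _ _ (E1 (geo p M) (fun x => EW (geo p' M) n (fun w => F (x :: w))))).
  apply: (E1_le lp (P := xpredT)) => [|m _]; first by elim: (geo p M).
  by apply: IH => c c' cc; apply: Fm => /=; rewrite leqnn.
apply: E1_geo_le => // m; apply: (EW_le lp') => w; apply: Fm => /=.
by rewrite leqnSn; elim: w => //= x w ->; rewrite leqnn.
Qed.

Lemma geo_mean p M : p != 1 ->
  E1 (geo p M) (fun m => m%:R) = p / (1 - p) * (1 - p ^+ M).
Proof.
move=> p1; have p1' : 1 - p != 0 by rewrite subr_eq0 eq_sym.
elim: M => [|M IH]; first by rewrite E1_geo0 expr0 subrr mulr0.
have -> : E1 (geo p M.+1) (fun m => m%:R) =
    p * (E1 (geo p M) (fun m => m%:R) + E1 (geo p M) (fun _ => 1)).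
  by rewrite E1_geoS mulr0 add0r -E1D; congr (_ * _); apply: E1_eq => m; rewrite -natr1.
have -> : E1 (geo p M) (fun _ => 1) = 1.
  elim: M {IH} => [|M IH]; first by rewrite E1_geo0.
  by rewrite E1_geoS IH; ring.
by rewrite IH exprS; field.
Qed.

Lemma geo_sqr p M : 0 <= p < 1 ->
  E1 (geo p M) (fun m => m%:R ^+ 2) <= p * (1 + p) / (1 - p) ^+ 2.
Proof.
move=> /andP[p0 p1]; have p1' : 0 < 1 - p by lra.
have p1n : p != 1 by rewrite lt_eqF.
elim: M => [|M IH].
  rewrite E1_geo0 expr0n /= divr_ge0 ?mulr_ge0 ?sqr_ge0 //; lra.
have lp : law (geo p M) by apply: geo_law; lra.
have -> : E1 (geo p M.+1) (fun m => m%:R ^+ 2) =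
    p * (E1 (geo p M) (fun m => m%:R ^+ 2) + 2 * E1 (geo p M) (fun m => m%:R) + 1).
  rewrite E1_geoS expr0n mulr0 add0r; congr (_ * _).
  rewrite -E1Z -[X in _ + X](E1_cst lp) -!E1D; apply: E1_eq => m /=.
  by rewrite -natr1; ring.
(* The bound is the second moment of the untruncated variable, a fixed point of the recursion once
   the mean is replaced by [p / (1 - p)]. *)
have -> : p * (1 + p) / (1 - p) ^+ 2 =
    p * (p * (1 + p) / (1 - p) ^+ 2 + 2 * (p / (1 - p)) + 1).
  by field; lra.
apply: ler_wpM2l => //; rewrite lerD2r; apply: lerD => //.
rewrite ler_pM2l ?ltr0n // geo_mean // ler_piMr ?divr_ge0 //; first lra.
by have := exprn_ge0 M p0; lra.
Qed.

Lemma geo_var p M (m := E1 (geo p M) (fun k => k%:R)) : 0 <= p < 1 ->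
  E1 (geo p M) (fun k => (k%:R - m) ^+ 2) <= p * (1 + p) / (1 - p) ^+ 2.
Proof.
move=> hp; apply: le_trans (geo_sqr M hp).
have lp : law (geo p M) by apply: geo_law; lra.
have -> : E1 (geo p M) (fun k => (k%:R - m) ^+ 2) =
    E1 (geo p M) (fun k => k%:R ^+ 2) + (- (2 * m)) * m + m ^+ 2.
  rewrite -[X in _ + _ * X + _]/(E1 (geo p M) (fun k => k%:R)) -E1Z -E1D.
  rewrite -[m ^+ 2](E1_cst lp) -E1D; apply: E1_eq => k; ring.
have := sqr_ge0 m; nra.
Qed.

(** Lets the truncation level tend to infinity: the stationarity errors are a geometric power times
    a constant affine in [M]. Halving the exponent gives two Bernoulli factors, hence decay of order
    [M ^ -2] of the power. *)
Lemma expr_affine_small p (A B e : R) : 0 <= p < 1 -> 0 <= A -> 0 <= B ->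
  0 < e -> exists M0, forall M, (M0 <= M)%N -> p ^+ M * (A * M%:R + B) <= e.
Proof.
move=> /andP[p0 p1] A0 B0 e0.
have [->|pn0] := eqVneq p 0.
  by exists 1%N => -[|M] // _; rewrite exprS !mul0r ltW.
have pp : 0 < p by rewrite lt_def pn0.
pose h := p^-1 - 1.
have h0 : 0 < h by rewrite /h subr_gt0 invf_gt1.
have pE : p = (1 + h)^-1 by rewrite /h addrC subrK invrK.
have bern m : 1 + m%:R * h <= (1 + h) ^+ m.
  elim: m => [|m IH]; first by rewrite mul0r addr0.
  have m0 : 0 <= m%:R :> R by [].
  have h1 : 0 <= 1 + h by lra.
  have := ler_wpM2l h1 IH; rewrite exprS -natr1; have := sqr_ge0 h; nra.
pose z := (3 * A + B) / (h ^+ 2 * e).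
have z0 : 0 <= z.
  by apply: divr_ge0; [lra | apply: mulr_ge0; [exact: sqr_ge0 | exact: ltW]].
have [N hN] : exists N : nat, z < N%:R.
  by exists (Num.truncn z).+1; rewrite truncnS_gt.
exists (2 * N.+1)%N => M hM.
have [m [hm hM1 hM2 m0]] :
    exists m, [/\ N < m, m + m <= M, M <= (2 * m).+1 & 0 < m]%N.
  by exists (M./2); clear -hM; split; lia.
have m1 : 1 <= m%:R :> R by rewrite ler1n.
have zm : z <= m%:R by apply: ltW; apply: lt_le_trans hN _; rewrite ler_nat ltnW.
have pM : p ^+ M <= ((m%:R * h) ^+ 2)^-1.
  apply: (@le_trans _ _ (p ^+ (m + m))).
    by apply: ler_wiXn2l; [lra | lra | exact: hM1].
  rewrite exprD pE exprVn -invfM -expr2 lef_pV2 ?posrE; last 2 first.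
  - by rewrite !exprn_gt0 //; lra.
  - by rewrite exprn_gt0 // mulr_gt0 //; lra.
  apply: lerXn2r; rewrite ?nnegrE.
  - by apply: mulr_ge0; lra.
  - by apply: exprn_ge0; lra.
  - by have := bern m; lra.
have MR : M%:R <= 2 * m%:R + 1 :> R.
  by rewrite -natrM natr1 ler_nat.
have le1 : A * M%:R + B <= (3 * A + B) * m%:R.
  have := ler_wpM2l A0 MR; nra.
have mh : 0 < m%:R * h by apply: mulr_gt0; lra.
apply: (@le_trans _ _ (((m%:R * h) ^+ 2)^-1 * ((3 * A + B) * m%:R))).
  apply: ler_pM => //; first exact: exprn_ge0.
  by apply: addr_ge0 => //; apply: mulr_ge0.
rewrite mulrC ler_pdivrMr ?exprn_gt0 //.
have e1 : (3 * A + B) = z * (h ^+ 2 * e).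
  rewrite /z divfK // mulf_neq0 ?expf_neq0 //; lra.
rewrite e1 exprMn.
have -> : e * (m%:R ^+ 2 * h ^+ 2) = m%:R * (h ^+ 2 * e) * m%:R by ring.
have he : 0 <= h ^+ 2 * e by apply: mulr_ge0; [exact: sqr_ge0 | exact: ltW].
by apply: ler_wpM2r => //; apply: ler_wpM2r.
Qed.

End Geometric.

(** * Stationarity of the chain with sources and sinks *)

Lemma profile_mono a c c' w : all2 leq c c' ->
  (profile a c w <= profile a c' w)%N.
Proof.
elim: c a c' => [|m r IH] a [|m' r'] //= /andP[mm /(IH a.+1)]; lia.
Qed.

Lemma profile_incr a u m v w :
  (profile a (u ++ m :: v) w <= profile a (u ++ m.+1 :: v) w
   <= (profile a (u ++ m :: v) w).+1)%N.
Proof.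
elim: u a => [|x u IH] a /=; first lia.
have := IH a.+1; lia.
Qed.

(** By [Lam_run] the final row size is [Lam] minus the number of sources, and of these only [Lam]
    depends on the sinks. *)
Lemma sumn_run_incr w u m v :
  all (fun x => x < (size (u ++ m :: v)).+2)%N w ->
  (sumn (run w (u ++ m :: v)) <= sumn (run w (u ++ m.+1 :: v))
   <= (sumn (run w (u ++ m :: v))).+1)%N.
Proof.
move=> hw; have h1 := Lam_run hw.
have hw' : all (fun x => x < (size (u ++ m.+1 :: v)).+2)%N w.
  by move: hw; rewrite !size_cat.
have h2 := Lam_run hw'; have := profile_incr 2 u m v w.
rewrite /Lam in h1 h2; move: h1 h2; clear; lia.
Qed.

Lemma sumn_bump c : (sumn (bump c) <= sumn c)%N.
Proof. elim: c => //= -[|m] r /=; lia. Qed.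

Lemma sumn_step x c : (sumn (step x c) <= (sumn c).+1)%N.
Proof.
case: x => [|[|j]] //=; first exact: leq_trans (sumn_bump _) _.
elim: c j => [|m r IH] [|j] //=; last by have := IH j; lia.
by have := sumn_bump r; lia.
Qed.

Lemma sumn_run w c : (sumn (run w c) <= sumn c + size w)%N.
Proof.
elim: w c => [|x w IH] c /=; first by rewrite addn0.
by have := IH (step x c); have := sumn_step x c; lia.
Qed.

Lemma all_bump B c : all (fun m => m <= B)%N c -> all (fun m => m <= B)%N (bump c).
Proof.
by elim: c => //= -[|m] r IH //= /andP[/ltnW-> ->].
Qed.

Section Stationarity.
Variable R : realType.
Implicit Types (p q K : R).

Lemma E1_near X (mu : seq (R * X)) (P : pred X) f g e : law mu ->
  all (fun a => P a.2) mu -> (forall x, P x -> `|f x - g x| <= e) ->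
  `|E1 mu f - E1 mu g| <= e.
Proof.
move=> lmu hP h.
have -> : E1 mu f - E1 mu g = E1 mu (fun x => f x - g x).
  by rewrite -mulN1r -E1Z -E1D; apply: E1_eq => x; rewrite mulN1r.
rewrite ler_norml -(E1_cst lmu e) -mulN1r -E1Z.
apply/andP; split; apply: (E1_le lmu hP) => x /h; rewrite ler_norml; lra.
Qed.

Lemma EW_near X (mu : seq (R * X)) (P : pred X) T F G e : law mu ->
  all (fun a => P a.2) mu ->
  (forall w, size w = T -> all P w -> `|F w - G w| <= e) ->
  `|EW mu T F - EW mu T G| <= e.
Proof.
move=> lmu hP h; rewrite -EWB ler_norml -(EW_cst lmu T e) -EWN.
apply/andP; split; apply: (EW_le_in lmu hP) => w sw /(h w sw);
  rewrite ler_norml; lra.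
Qed.

Lemma E1_all X (mu : seq (R * X)) : all (fun a => xpredT a.2) mu.
Proof. by elim: mu. Qed.

(* The letter is a source with weight [p^-1] and each row with weight [1]; the
   right-hand side is the effect of truncating the geometric laws. *)
Lemma geo_stationary p M K n (F : seq nat -> R) : 0 < p < 1 -> 0 <= K ->
  (forall u m v, size (u ++ m :: v) = n ->
     all (fun x => x <= M.+2)%N (u ++ m.+1 :: v) ->
     `|F (u ++ m.+1 :: v) - F (u ++ m :: v)| <= K) ->
  `|EW (geo p M.+1) n (fun c => p^-1 * F (bump c) +
        \sum_(i <- iota 0 n) F (ins i c))
    - (p^-1 + n%:R) * EW (geo p M.+1) n F| <= 2 * n%:R * (p ^+ M.+1 * K).
Proof.
move=> /andP[p0 p1] K0; set e := p ^+ M.+1 * K.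
have pM0 : 0 <= p ^+ M.+1 by apply/exprn_ge0/ltW.
have pn0 : p != 0 by rewrite gt_eqF.
have lp N : law (geo p N) by apply: geo_law; rewrite !ltW.
have e0 : 0 <= e by apply: mulr_ge0 => //; apply/exprn_ge0/ltW.
elim: n F => [|n IH] F hF.
  by rewrite /= big_nil addr0 addr0 subrr normr0 mulr0 mul0r.
pose G c := EW (geo p M.+1) n (fun w => F (c :: w)).
pose Gb c := EW (geo p M.+1) n (fun w => F (c :: bump w)).
pose Gi c := EW (geo p M.+1) n (fun w => \sum_(i <- iota 0 n) F (c :: ins i w)).
have supp : all (fun a : R * nat => a.2 <= M.+1)%N (geo p M.+1) by apply: geo_supp.
have allS w : all (fun x => x <= M.+1)%N w -> all (fun x => x <= M.+2)%N w.
  by apply: sub_all => x; apply: leqW.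
(* Memorylessness of the first coordinate: conditioned to be positive and lowered by one, it has law
   [geo p M]; the zero entry, which lets the bump pass on, and the entries raised by [ins 0]
   together rebuild [p^-1] times [geo p M.+2]. Replacing either law by [geo p M.+1] then costs
   [e]. *)
have -> : EW (geo p M.+1) n.+1 (fun c => p^-1 * F (bump c) +
        \sum_(i <- iota 0 n.+1) F (ins i c)) =
    E1 (geo p M) G + p^-1 * E1 (geo p M.+2) Gb + E1 (geo p M.+1) Gi.
  have -> : E1 (geo p M) G + p^-1 * E1 (geo p M.+2) Gb =
      E1 (geo p M.+1) (fun c => p^-1 * (if c is c'.+1 then G c' else Gb 0%N)
                          + Gb c.+1).
    rewrite E1D E1Z [E1 (geo p M.+2) Gb]E1_geoS [X in _ = p^-1 * X + _]E1_geoS.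
    by rewrite -[E1 (geo p M) (fun m => G m)]/(E1 (geo p M) G); field.
  rewrite -E1D /=; apply: E1_eq => c.
  have iS : iota 1 n = [seq i.+1 | i <- iota 0 n] by rewrite -(iotaDl 1 0).
  case: c => [|c]; rewrite /G /Gb /Gi -EWZ -!EWD; apply: EW_eq => w;
    by rewrite big_cons iS big_map /=; ring.
have h1 : `|E1 (geo p M.+1) G - E1 (geo p M) G| <= e.
  rewrite E1_geo_shift normrM (ger0_norm pM0).
  rewrite /e; apply: ler_wpM2l => //.
  apply: (EW_near (P := fun x => (x <= M.+1)%N) (lp _) supp) => w sw aw.
  by apply: (hF [::]); [rewrite /= sw | apply/andP; split; [exact: leqnSn | exact: allS]].
have h2 : `|p^-1 * E1 (geo p M.+2) Gb - p^-1 * E1 (geo p M.+1) Gb| <= e.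
  rewrite -mulrBr E1_geo_shift mulrA exprS mulKf // normrM.
  rewrite (ger0_norm pM0).
  rewrite /e; apply: ler_wpM2l => //.
  apply: (EW_near (P := fun x => (x <= M.+1)%N) (lp _) supp) => w sw aw.
  by apply: (hF [::]); [rewrite /= size_bump sw | apply/andP; split; [exact: leqnn | apply/all_bump/allS]].
have h3 : `|(p^-1 * E1 (geo p M.+1) Gb + E1 (geo p M.+1) Gi)
           - (p^-1 + n%:R) * E1 (geo p M.+1) G| <= 2 * n%:R * e.
  rewrite -!E1Z -E1D; apply: (E1_near (P := fun x => (x <= M.+1)%N) (lp _) supp) => c hc.
  rewrite /Gb /Gi -EWZ -EWD; apply: IH => u m v hs ha.
  by apply: (hF (c :: u)); rewrite /= ?hs // ha leqW.
rewrite -[EW _ n.+1 F]/(E1 (geo p M.+1) G) -natr1.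
move: h1 h2 h3; rewrite !ler_norml.
move: (E1 (geo p M) G) (E1 (geo p M.+1) G) (_ * E1 (geo p M.+2) Gb)
  (p^-1 * E1 (geo p M.+1) Gb) (E1 (geo p M.+1) Gi) => a b c d f.
move=> /andP[a1 a2] /andP[b1 b2] /andP[c1 c2]; clear -a1 a2 b1 b2 c1 c2.
by apply/andP; split; lra.
Qed.

(** One column carries at most one point: a source with probability [s], and a point in each given
    row with probability [q]. The blank takes the remaining mass, so [s] and [q] vary
    independently. *)
Definition letters (s q : R) (n : nat) : seq (R * nat) :=
  (1 - s - n%:R * q, 0%N) :: (s, 1%N) :: [seq (q, i.+2) | i <- iota 0 n].

Lemma E1_letters s q n f : E1 (letters s q n) f =
  (1 - s - n%:R * q) * f 0%N + s * f 1%N + q * \sum_(i <- iota 0 n) f i.+2.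
Proof.
by rewrite /E1 !big_cons big_map mulr_sumr addrA.
Qed.

Lemma letters_law s q n : 0 <= s -> 0 <= q -> s + n%:R * q <= 1 ->
  law (letters s q n).
Proof.
move=> s0 q0 h; split.
  rewrite /= s0 all_map; apply/andP; split; first lra.
  by apply/allP => i _ /=.
rewrite E1_letters big_const_seq count_predT size_iota iter_addr addr0.
by rewrite -[1 *+ n]/(n%:R); ring.
Qed.

Lemma letters_supp s q n : all (fun a => a.2 < n.+2)%N (letters s q n).
Proof.
by rewrite /= all_map; apply/allP => i /=; rewrite mem_iota.
Qed.

(** Each letter costs one use of [geo_stationary], applied to the conditional expectation over the
    remaining letters, which inherits its Lipschitz bound from [sumn_run_incr]. The bound on [H] is
    asked only on reachable row sizes, so that [H] may be a square. *)
Lemma run_stationary p q M K n T (H : nat -> R) : 0 < p < 1 -> 0 <= K ->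
  0 <= q -> (p^-1 + n%:R) * q <= 1 ->
  (forall s s', (s <= s' <= s.+1)%N -> (s' <= n * M.+2 + T)%N ->
     `|H s' - H s| <= K) ->
  `|EW (geo p M.+1) n (fun c => EW (letters (p^-1 * q) q n) T
       (fun w => H (sumn (run w c)))) - EW (geo p M.+1) n (fun c => H (sumn c))|
  <= T%:R * (q * (2 * n%:R * (p ^+ M.+1 * K))).
Proof.
move=> hp K0 q0 hq hH; have /andP[p0 p1] := hp.
have pV0 : 0 <= p^-1 by rewrite invr_ge0 ltW.
have lp : law (geo p M.+1) by apply: geo_law; lra.
have ll : law (letters (p^-1 * q) q n).
  by apply: letters_law => //; rewrite ?mulr_ge0 // -mulrDl.
elim: T hH => [|T IH] hH.
  by rewrite /= subrr normr0 mul0r.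
have {}IH := IH (fun s s' h1 h2 => hH s s' h1 (leq_trans h2 (leq_add (leqnn _) (leqnSn T)))).
pose Psi c := EW (letters (p^-1 * q) q n) T (fun w => H (sumn (run w c))).
have one : `|EW (geo p M.+1) n (fun c => E1 (letters (p^-1 * q) q n) (fun x => Psi (step x c)))
   - EW (geo p M.+1) n Psi| <= q * (2 * n%:R * (p ^+ M.+1 * K)).
  have := @geo_stationary p M K n Psi hp K0.
  set A := EW _ _ _; set B := EW _ _ Psi; move=> h.
  have -> : EW (geo p M.+1) n (fun c => E1 (letters (p^-1 * q) q n) (fun x => Psi (step x c)))
     = (1 - p^-1 * q - n%:R * q) * B + q * A.
    rewrite /A /B -!EWZ -EWD; apply: EW_eq => c; rewrite E1_letters /=; ring.
  have -> : (1 - p^-1 * q - n%:R * q) * B + q * A - B = q * (A - (p^-1 + n%:R) * B).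
    ring.
  rewrite normrM ger0_norm //; apply: ler_wpM2l => //.
  apply: h => u m v hs ha; apply: (EW_near (P := fun x => (x < n.+2)%N) ll (letters_supp _ _ _)) => w sw aw.
  apply: hH.
    by apply: sumn_run_incr; rewrite hs.
  apply: leq_trans (sumn_run _ _) _; rewrite sw; apply: leq_add => //.
  have {hs}<- : size (u ++ m.+1 :: v) = n by rewrite -hs !size_cat.
  elim: (u ++ m.+1 :: v) ha => //= x r IHr /andP[hx /IHr]; rewrite mulSn.
  by move=> h2; apply: leq_add.
rewrite [X in `|X - _|](_ : _ =
  EW (geo p M.+1) n (fun c => E1 (letters (p^-1 * q) q n) (fun x => Psi (step x c)))) //.
have := ler_normD (EW (geo p M.+1) n (fun c => E1 (letters (p^-1 * q) q n) (fun x => Psi (step x c)))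
   - EW (geo p M.+1) n Psi) (EW (geo p M.+1) n Psi - EW (geo p M.+1) n (fun c => H (sumn c))).
rewrite addrA subrK => /le_trans; apply.
by rewrite -natr1 mulrDl mul1r addrC; apply: lerD.
Qed.

End Stationarity.

(** * Moments of the path length with sources and sinks *)

Lemma lnd_insert_lt a u x v : (x < a)%N -> lnd a (u ++ x :: v) = lnd a (u ++ v).
Proof.
elim: u a => [|y u IH] a xa /=; first by rewrite leqNgt xa.
rewrite IH //; case: ifP => // ay; rewrite IH //; exact: leq_trans xa ay.
Qed.

Lemma profile_insert_lt a c u x v : (x < a)%N ->
  profile a c (u ++ x :: v) = profile a c (u ++ v).
Proof.
by elim: c a => //= m r IH a xa; rewrite lnd_insert_lt // IH // leqW.
Qed.

Section Sources.
Variable R : realType.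
Implicit Types (p q s eta : R).

Definition src_mean s q n T : R := EW (letters s q n) T (fun w => (lnd 1 w)%:R).

Lemma natr_sumn c : (sumn c)%:R = \sum_(m <- c) m%:R :> R.
Proof. by rewrite sumnE natr_sum. Qed.

Lemma natr_count (c : nat) w : (count_mem c w)%:R = \sum_(x <- w) (x == c)%:R :> R.
Proof.
by elim: w => [|x w IH] /=; rewrite ?big_nil ?big_cons // natrD IH.
Qed.

Lemma E1_letters_src s q n : E1 (letters s q n) (fun x => (x == 1%N)%:R) = s.
Proof.
by rewrite E1_letters big1 //= ?mulr0 mulr1 add0r addr0.
Qed.

Lemma letters_src_var s q n T : 0 <= s -> 0 <= q -> s + n%:R * q <= 1 ->
  EW (letters s q n) T (fun w => ((count_mem 1%N w)%:R - T%:R * s) ^+ 2)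
  <= T%:R * s.
Proof.
move=> s0 q0 h; have ll := letters_law s0 q0 h.
under EW_eq => w do rewrite natr_count.
rewrite (EW_var ll _ (E1_letters_src s q n)); apply: ler_wpM2l => //.
rewrite E1_letters /= (eq_bigr (fun _ => s ^+ 2)); last by move=> i _ /=; ring.
rewrite big_const_seq count_predT size_iota iter_addr addr0 -mulr_natl.
have : 0 <= n%:R * q :> R by rewrite mulr_ge0.
have := sqr_ge0 s; nra.
Qed.

Definition sink_mean p M : R := E1 (geo p M.+1) (fun m => m%:R).

Lemma sink_mean_bounds p M : 0 < p < 1 ->
  p / (1 - p) - p / (1 - p) * p ^+ M.+1 = sink_mean p M /\
  0 <= sink_mean p M <= p / (1 - p).
Proof.
move=> /andP[p0 p1].
have E : p / (1 - p) - p / (1 - p) * p ^+ M.+1 = sink_mean p M.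
  by rewrite /sink_mean geo_mean ?lt_eqF //; ring.
split=> //; rewrite -E.
have h : 0 <= p / (1 - p) by apply: divr_ge0; lra.
have h1 : 0 <= p ^+ M.+1 <= 1.
  by apply/andP; split; [apply/exprn_ge0/ltW | apply: exprn_ile1; apply: ltW].
nra.
Qed.

Lemma sinks_var p M n : 0 < p < 1 ->
  EW (geo p M.+1) n (fun c => ((sumn c)%:R - n%:R * sink_mean p M) ^+ 2) <=
  n%:R * (p * (1 + p) / (1 - p) ^+ 2).
Proof.
move=> /andP[p0 p1]; have lp : law (geo p M.+1) by apply: geo_law; lra.
under EW_eq => w do rewrite natr_sumn.
rewrite (EW_var lp (f := fun m => m%:R) _ erefl); apply: ler_wpM2l => //.
by apply: geo_var; lra.
Qed.

Lemma sinks_sqr p M n : 0 < p < 1 ->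
  EW (geo p M.+1) n (fun c => (sumn c)%:R ^+ 2) <=
  n%:R * (p * (1 + p) / (1 - p) ^+ 2) + (n%:R * (p / (1 - p))) ^+ 2.
Proof.
move=> hp; have /andP[p0 p1] := hp.
have lp : law (geo p M.+1) by apply: geo_law; lra.
have [_ /andP[m0 m1]] := sink_mean_bounds M hp.
set m := n%:R * sink_mean p M.
have -> : EW (geo p M.+1) n (fun c => (sumn c)%:R ^+ 2) =
   EW (geo p M.+1) n (fun c => ((sumn c)%:R - m) ^+ 2) + m ^+ 2.
  have e1 : EW (geo p M.+1) n (fun c => (sumn c)%:R - m) = 0.
    under EW_eq => w do rewrite natr_sumn.
    by rewrite EWB EW_mean // EW_cst // subrr.
  rewrite -[RHS]addr0 -(mulr0 (2 * m)) -e1 -EWZ -(EW_cst lp n (m ^+ 2)) -!EWD.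
  by apply: EW_eq => c; ring.
apply: lerD; first exact: sinks_var.
have r0 : 0 <= p / (1 - p) by apply: divr_ge0; lra.
apply: lerXn2r; rewrite ?nnegrE /m; first exact: mulr_ge0.
  exact: mulr_ge0.
exact: ler_wpM2l.
Qed.

Definition joint p q n T M (F : seq nat -> seq nat -> R) : R :=
  EW (geo p M.+1) n (fun c => EW (letters (p^-1 * q) q n) T (F c)).

(** The path length is the number of sources plus the final row size, each with nearly known mean
    and variance. The two are dependent, so the variance of the sum is bounded by twice the sum of
    the variances; [e] absorbs the truncation. *)
Lemma Lam_moments p q n T e : 0 < p < 1 -> 0 <= q ->
  (p^-1 + n%:R) * q <= 1 -> 0 < e ->
  exists M0, forall M, (M0 <= M)%N ->
    let m := T%:R * (p^-1 * q) + n%:R * sink_mean p M in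
    [/\ `|joint p q n T M (fun c w => (Lam c w)%:R) - m| <= e,
        joint p q n T M (fun c w => ((Lam c w)%:R - m) ^+ 2) <=
          2 * (T%:R * (p^-1 * q)) + 2 * (n%:R * (p * (1 + p) / (1 - p) ^+ 2)) + e
      & `|n%:R * sink_mean p M - n%:R * (p / (1 - p))| <= e].
Proof.
move=> hp q0 hq e0; have /andP[p0 p1] := hp.
have r0 : 0 <= p / (1 - p) by apply: divr_ge0; lra.
pose B0 : R := n%:R * (p / (1 - p)).
have B00 : 0 <= B0 by rewrite mulr_ge0.
pose D : R := T%:R * (q * (2 * n%:R)).
have D0 : 0 <= D by rewrite !mulr_ge0.
(* A Lipschitz constant, on the reachable row sizes, for both the size and its squared deviation; it
   is affine in [M]. *)
pose K M : R := 2 * n%:R * M.+1%:R + (2 * n%:R + 2 * T%:R + 2 * B0 + 1).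
have hp' : 0 <= p < 1 by lra.
have hA : 0 <= D * (2 * n%:R) by rewrite !mulr_ge0.
have hB : 0 <= D * (2 * n%:R + 2 * T%:R + 2 * B0 + 1) + B0.
  have n0 : 0 <= n%:R :> R by [].
  have T0 : 0 <= T%:R :> R by [].
  apply: addr_ge0 => //; apply: mulr_ge0 => //; lra.
have he2 : 0 < e / 2 by lra.
have [M0 hM0] := expr_affine_small hp' hA hB he2.
exists M0 => M hM m.
have {hM0} hs := hM0 M.+1 (leqW hM).
have lp : law (geo p M.+1) by apply: geo_law; lra.
have pV0 : 0 <= p^-1 by rewrite invr_ge0 ltW.
have ll : law (letters (p^-1 * q) q n).
  by apply: letters_law => //; rewrite ?mulr_ge0 // -mulrDl.
have hq' : p^-1 * q + n%:R * q <= 1 by rewrite -mulrDl.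
have pM0 : 0 <= p ^+ M.+1 by apply/exprn_ge0/ltW.
have K1 : 1 <= K M.
  have h1 : 0 <= 2 * n%:R * M.+1%:R :> R by rewrite !mulr_ge0.
  have h2 : 0 <= n%:R :> R by []. 
  have h3 : 0 <= T%:R :> R by [].
  by rewrite /K; lra.
have K0 : 0 <= K M by apply: le_trans K1.
have errE : T%:R * (q * (2 * n%:R * (p ^+ M.+1 * K M))) + p ^+ M.+1 * B0 <= e / 2.
  apply: le_trans hs; rewrite le_eqVlt; apply/orP; left; apply/eqP.
  by rewrite /K /D; ring.
have [mE /andP[mu0 mu1]] := sink_mean_bounds M hp.
set err := T%:R * _ in errE.
have err0 : 0 <= err by rewrite /err !mulr_ge0.
have pB0 : 0 <= p ^+ M.+1 * B0 by rewrite mulr_ge0.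
pose a : R := n%:R * sink_mean p M.
have a0 : 0 <= a by rewrite mulr_ge0.
have aB : a <= B0 by apply: ler_wpM2l.
have jE (F : nat -> nat -> R) :
    joint p q n T M (fun c w => F (Lam c w) (count_mem 1%N w)) =
    joint p q n T M (fun c w => F (count_mem 1%N w + sumn (run w c))%N (count_mem 1%N w)).
  apply: (EW_ext (P := xpredT)) => [|c sc _]; first exact: E1_all.
  apply: (EW_ext (P := fun x => x < n.+2)%N) => [|w sw hw].
    exact: letters_supp.
  by rewrite Lam_run // sc.
have cst F : joint p q n T M (fun c w => F w) = EW (letters (p^-1 * q) q n) T F.
  by rewrite /joint EW_cst.
have st1 : `|joint p q n T M (fun c w => (sumn (run w c))%:R) - a| <= err.
  have := @run_stationary R p q M (K M) n T (fun k => k%:R) hp K0 q0 hq.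
  have -> : EW (geo p M.+1) n (fun c => (sumn c)%:R) = a.
    by under EW_eq => c do rewrite natr_sumn; rewrite EW_mean.
  apply=> s s' /andP[h1 h2] _.
  rewrite -natrB // normr_nat; apply: le_trans K1; rewrite lern1 leq_subLR.
  by rewrite addn1.
have st2 : joint p q n T M (fun c w => ((sumn (run w c))%:R - a) ^+ 2) <=
    n%:R * (p * (1 + p) / (1 - p) ^+ 2) + err.
  have := @run_stationary R p q M (K M) n T (fun k => (k%:R - a) ^+ 2) hp K0 q0 hq.
  rewrite ler_norml => h; have {h} : 
    joint p q n T M (fun c w => ((sumn (run w c))%:R - a) ^+ 2) -
    EW (geo p M.+1) n (fun c => ((sumn c)%:R - a) ^+ 2) <= err.
    apply: (proj2 (andP (h _))) => s s' /andP[h1 h2] h3.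
    have S1 : s%:R <= s'%:R :> R by rewrite ler_nat.
    have S2 : s'%:R <= s%:R + 1 :> R by rewrite natr1 ler_nat.
    have S3 : s'%:R <= n%:R * (M.+1%:R + 1) + T%:R :> R.
      by rewrite natr1 -natrM -natrD ler_nat.
    have S0 : 0 <= s%:R :> R by [].
    rewrite ler_norml /K.
    have -> : (s'%:R - a) ^+ 2 - (s%:R - a) ^+ 2 = (s'%:R - s%:R) * (s'%:R + s%:R - 2 * a) :> R.
      by ring.
    have b1 : - (2 * s'%:R + 2 * B0) <= s'%:R + s%:R - 2 * a <= 2 * s'%:R + 2 * B0.
      by clear -S0 S1 S2 a0 aB; apply/andP; split; lra.
    have b2 : 2 * s'%:R + 2 * B0 <= K M by rewrite /K; lra.
    rewrite -/(K M); clear -b1 b2 S1 S2; move: (s'%:R + s%:R - 2 * a) b1 => z b1.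
    by have /andP[b3 b4] := b1; apply/andP; split; nra.
  by have := sinks_var M n hp; rewrite -/a; lra.
split.
- rewrite (jE (fun x _ => x%:R)).
  have -> : joint p q n T M (fun c w => (count_mem 1%N w + sumn (run w c))%:R) =
    T%:R * (p^-1 * q) + joint p q n T M (fun c w => (sumn (run w c))%:R).
    have -> : T%:R * (p^-1 * q) =
        EW (letters (p^-1 * q) q n) T (fun w => (count_mem 1%N w)%:R).
      by under EW_eq => w do rewrite natr_count; rewrite EW_mean // E1_letters_src.
    rewrite -cst /joint -EWD; apply: EW_eq => c.
    by rewrite -EWD; apply: EW_eq => w; rewrite natrD.
  rewrite /m -/a opprD addrACA subrr add0r; apply: le_trans st1 _; lra.
- rewrite (jE (fun x _ => (x%:R - m) ^+ 2)).
  apply: (@le_trans _ _ (2 * EW (letters (p^-1 * q) q n) T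
     (fun w => ((count_mem 1%N w)%:R - T%:R * (p^-1 * q)) ^+ 2) +
     2 * joint p q n T M (fun c w => ((sumn (run w c))%:R - a) ^+ 2))).
    rewrite -cst /joint -!EWZ -EWD; apply: (EW_le lp) => c.
    rewrite -!EWZ -EWD; apply: (EW_le ll) => w; rewrite natrD /m -/a.
    have sq (x y z t : R) :
        (x + z - (y + t)) ^+ 2 <= 2 * (x - y) ^+ 2 + 2 * (z - t) ^+ 2.
      by have := sqr_ge0 ((x - y) - (z - t)); nra.
    exact: sq.
  have := @letters_src_var (p^-1 * q) q n T (mulr_ge0 pV0 q0) q0 hq'; lra.
- rewrite -/a -/B0 distrC ger0_norm ?subr_ge0 //.
  have -> : B0 - a = p ^+ M.+1 * B0 by rewrite /B0 /a -mE; ring.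
  lra.
Qed.

(** Dropping the sinks only shortens the path, and the truncation error is arbitrarily small. *)
Lemma src_mean_le p q n T : 0 < p < 1 -> 0 <= q -> (p^-1 + n%:R) * q <= 1 ->
  src_mean (p^-1 * q) q n T <= T%:R * (p^-1 * q) + n%:R * (p / (1 - p)).
Proof.
move=> hp q0 hq; have /andP[p0 p1] := hp.
apply/ler_addgt0Pr => e e0; have e2 : 0 < e / 2 by lra.
have [M0 /(_ M0 (leqnn _)) [h1 _ h3]] := Lam_moments T hp q0 hq e2.
have lp : law (geo p M0.+1) by apply: geo_law; lra.
have pV0 : 0 <= p^-1 by rewrite invr_ge0 ltW.
have ll : law (letters (p^-1 * q) q n).
  by apply: letters_law => //; rewrite ?mulr_ge0 // -mulrDl.
have : src_mean (p^-1 * q) q n T <= joint p q n T M0 (fun c w => (Lam c w)%:R).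
  rewrite -(EW_cst lp n (src_mean _ _ _ _)); apply: (EW_le lp) => c.
  by apply: (EW_le ll) => w; rewrite ler_nat leq_maxl.
by move: h1 h3; rewrite !ler_norml => /andP[_ h1] /andP[_ h3]; lra.
Qed.

End Sources.

(** * Removing sinks and sources *)

Section LowerBound.
Variable R : realType.
Implicit Types (p q eta : R).

(** Blanks and sources are both invisible to [F], so only their total mass matters. *)
Lemma EW_letters_src (s s' q : R) n T (F : seq nat -> R) :
  (forall u x v, (x < 2)%N -> F (u ++ x :: v) = F (u ++ v)) ->
  EW (letters s q n) T F = EW (letters s' q n) T F.
Proof.
elim: T F => [|T IH] F hF //=.
have hFx x : forall u y v, (y < 2)%N -> F (x :: u ++ y :: v) = F (x :: u ++ v).
  by move=> u y v; apply: (hF (x :: u)).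
have e0 (r : R) x : (x < 2)%N ->
    EW (letters r q n) T (fun w => F (x :: w)) = EW (letters r q n) T F.
  by move=> hx; apply: EW_eq => w; apply: (hF [::]).
rewrite !E1_letters !e0 // (IH F) //.
rewrite (eq_bigr (fun i => EW (letters s' q n) T (fun w => F (i.+2 :: w)))).
  ring.
by move=> i _; apply: IH => u y v; apply: (hFx i.+2).
Qed.

Lemma sqr_pos_part_le (x : R) : Num.max x 0 ^+ 2 <= x ^+ 2.
Proof.
by case: (leP x 0) => h; rewrite ?expr0n ?sqr_ge0.
Qed.

(* If sinks beat sources, the path length [b] is atypical either for the
   sink-richer law centred at [x1] or for the law centred at [x2]. *)
Lemma sink_exit_cost (a b c x1 x2 g eta : R) : 0 < g -> 0 < eta ->
  g / 2 <= x2 - x1 -> b <= c + a ->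
  Num.max a b <= a + eta * c ^+ 2 +
    2 / (eta * g ^+ 2) * (Num.max (b - x1) 0 ^+ 2 + (Num.max a b - x2) ^+ 2).
Proof.
move=> g0 eta0 hg hb; set C := 2 / _.
have C0 : 0 < C by rewrite divr_gt0 // mulr_gt0 // exprn_gt0.
have h1 := mulr_ge0 (ltW eta0) (sqr_ge0 c).
have h2 : 0 <= C * (Num.max (b - x1) 0 ^+ 2 + (Num.max a b - x2) ^+ 2).
  by apply: mulr_ge0; [exact: ltW | apply: addr_ge0; exact: sqr_ge0].
have [ba|ab] := leP b a; first by move: h2; rewrite (max_idPl ba); lra.
move: h2; rewrite (max_idPr (ltW ab)) => _.
set d := Num.max (b - x1) 0; set e := b - x2.
have d1 : b - x1 <= d by rewrite le_max lexx.
have de : g ^+ 2 / 8 <= d ^+ 2 + e ^+ 2.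
  have : g / 2 <= d - e by rewrite /e; lra.
  have := sqr_ge0 (d + e); have : 0 <= d by rewrite le_max lexx orbT.
  by clear -g0 => ? ? ?; nra.
have k1 : (4 * eta)^-1 = C * (g ^+ 2 / 8).
  by rewrite /C; field; rewrite ?gt_eqF.
have k2 := ler_wpM2l (ltW C0) de.
have k3 : c <= eta * c ^+ 2 + (4 * eta)^-1.
  have := sqr_ge0 (2 * eta * c - 1).
  have e4 : 0 < (4 * eta)^-1 by rewrite invr_gt0 mulr_gt0.
  move=> /(mulr_ge0 (ltW e4)).
  have -> : (4 * eta)^-1 * (2 * eta * c - 1) ^+ 2 = eta * c ^+ 2 + (4 * eta)^-1 - c.
    by field; rewrite gt_eqF.
  by lra.
by rewrite -/d -/e; lra.
Qed.

Lemma sqr_pos_part_mono (x y : R) :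
  x <= y -> Num.max x 0 ^+ 2 <= Num.max y 0 ^+ 2.
Proof.
move=> xy; apply: lerXn2r; rewrite ?nnegrE.
- by rewrite le_max lexx orbT.
- by rewrite le_max lexx orbT.
by rewrite ge_max !le_max xy lexx orbT.
Qed.

(** Two stationary systems are compared: [p1] has fewer sources, more sinks, and a mean smaller by
    [g]. A path through the sinks of [p] ignores the sources, so it is stochastically dominated by
    the path length of the system [p1], where a length near the larger mean is atypical. The cost of
    leaving through the sinks is thus controlled by second moments, with [eta] balancing the two
    contributions. *)
Lemma src_mean_ge p p1 q n T eta (g := (T%:R * (p^-1 * q) + n%:R * (p / (1 - p)))
     - (T%:R * (p1^-1 * q) + n%:R * (p1 / (1 - p1)))) :
  0 < p -> p < p1 -> p1 < 1 -> 0 <= q -> (p^-1 + n%:R) * q <= 1 ->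
  0 < g -> 0 < eta ->
  T%:R * (p^-1 * q) + n%:R * (p / (1 - p)) - 2
  - eta * (n%:R * (p * (1 + p) / (1 - p) ^+ 2) + (n%:R * (p / (1 - p))) ^+ 2)
  - 2 / (eta * g ^+ 2) * (2 * (T%:R * (p^-1 * q)) +
       2 * (n%:R * (p * (1 + p) / (1 - p) ^+ 2)) +
       (2 * (T%:R * (p1^-1 * q)) + 2 * (n%:R * (p1 * (1 + p1) / (1 - p1) ^+ 2))) + 2)
  <= src_mean (p^-1 * q) q n T.
Proof.
move=> p0 pp1 p11 q0 hq g0 eta0.
have hp : 0 < p < 1 by lra.
have hp1 : 0 < p1 < 1 by lra.
have pV : p1^-1 <= p^-1 by rewrite lef_pV2 ?posrE; lra.
have pV1 : 0 <= p1^-1 by rewrite invr_ge0; lra.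
have hq1 : (p1^-1 + n%:R) * q <= 1.
  by apply: le_trans hq; apply: ler_wpM2r => //; lra.
(* Small enough to keep the truncated centres [g / 2] apart; the bound by [1] yields the two
   constants [2] of the statement. *)
pose e : R := Num.min 1 (g / 4).
have e0 : 0 < e by rewrite lt_min ltr01 divr_gt0.
have e1 : e <= 1 by rewrite ge_min lexx.
have e2 : e <= g / 4 by rewrite ge_min lexx orbT.
have [M1 hM1] := Lam_moments T hp q0 hq e0.
have [M2 hM2] := Lam_moments T hp1 q0 hq1 e0.
pose M := maxn M1 M2.
have {hM1} := hM1 M (leq_maxl _ _); have {hM2} := hM2 M (leq_maxr _ _).
set x1 := T%:R * (p1^-1 * q) + n%:R * sink_mean p1 M.
set x2 := T%:R * (p^-1 * q) + n%:R * sink_mean p M.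
move=> [_ v1 m1] [l2 v2 m2].
have lp : law (geo p M.+1) by apply: geo_law; lra.
have ll (s : R) : 0 <= s -> (s + n%:R) * q <= 1 -> law (letters (s * q) q n).
  by move=> s0 hs; apply: letters_law; rewrite ?mulr_ge0 // -mulrDl.
have pV0 : 0 <= p^-1 by apply: le_trans pV.
have x21 : g / 2 <= x2 - x1.
  move: m1 m2; rewrite !ler_norml => /andP[a1 a2] /andP[a3 a4].
  by clear -a1 a2 a3 a4 e2; rewrite /g /x1 /x2 in e2 *; lra.
set C := 2 / (eta * g ^+ 2).
have C0 : 0 < C by rewrite divr_gt0 // mulr_gt0 // exprn_gt0.
pose posB c w : R := Num.max ((profile 2 c w)%:R - x1) 0 ^+ 2.
(* [profile 2] does not see the sources, so their intensity may be lowered for free; passing from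
   [p] to [p1] then only adds sinks. *)
have dom : joint p q n T M posB <= 2 * (T%:R * (p1^-1 * q)) +
    2 * (n%:R * (p1 * (1 + p1) / (1 - p1) ^+ 2)) + e.
  apply: le_trans v1.
  have -> : joint p q n T M posB =
      EW (geo p M.+1) n (fun c => EW (letters (p1^-1 * q) q n) T (posB c)).
    apply: EW_eq => c; apply: EW_letters_src => u x v hx.
    by rewrite /posB profile_insert_lt.
  apply: (@le_trans _ _ (EW (geo p1 M.+1) n
      (fun c => EW (letters (p1^-1 * q) q n) T (posB c)))).
    apply: EW_geo_le; [exact: ltW | exact: ltW | exact: ltW |].
    move=> c c' cc; apply: (EW_le (ll _ pV1 hq1)) => w.
    by apply: sqr_pos_part_mono; rewrite lerD2r ler_nat profile_mono.
  apply: EW_le; first by apply: geo_law; lra.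
  move=> c; apply: (EW_le (ll _ pV1 hq1)) => w.
  apply: le_trans (sqr_pos_part_le _).
  by apply: sqr_pos_part_mono; rewrite lerD2r ler_nat leq_maxr.
have main : joint p q n T M (fun c w => (Lam c w)%:R) <=
   src_mean (p^-1 * q) q n T + eta * EW (geo p M.+1) n (fun c => (sumn c)%:R ^+ 2)
   + C * (joint p q n T M posB +
          joint p q n T M (fun c w => ((Lam c w)%:R - x2) ^+ 2)).
  have l0 := ll _ pV0 hq.
  rewrite -(EW_cst lp n (src_mean _ _ _ _)) /joint -EWZ -!EWD -EWZ -EWD.
  apply: (EW_le lp) => c.
  rewrite -[eta * _](EW_cst l0 T) -!EWD -EWZ -!EWD; apply: (EW_le l0) => w.
  have -> : (Lam c w)%:R = Num.max (lnd 1 w)%:R (profile 2 c w)%:R :> R.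
    rewrite /Lam; case: (leqP (lnd 1 w) (profile 2 c w)) => h.
      by rewrite (max_idPr _) // ler_nat.
    by rewrite (max_idPl _) // ler_nat ltnW.
  rewrite /posB; apply: sink_exit_cost => //.
  rewrite -natrD ler_nat; apply: leq_trans (profile_le _ _ _) _.
  by rewrite leq_add2l lnd_anti.
have sq := ler_wpM2l (ltW eta0) (sinks_sqr M n hp).
have y3 : C * (joint p q n T M posB +
    joint p q n T M (fun c w => ((Lam c w)%:R - x2) ^+ 2)) <=
    C * (2 * (T%:R * (p^-1 * q)) + 2 * (n%:R * (p * (1 + p) / (1 - p) ^+ 2)) +
       (2 * (T%:R * (p1^-1 * q)) + 2 * (n%:R * (p1 * (1 + p1) / (1 - p1) ^+ 2))) + 2).
  apply: ler_wpM2l; first exact: ltW.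
  by apply: le_trans (lerD dom v2) _; clear -e1; lra.
move: l2 m2 main sq; rewrite !ler_norml => /andP[l2 _] /andP[m2 _].
rewrite /x2 in l2; move: y3 l2 m2; move: (C * _) (C * _) (eta * _) (eta * _).
move: (joint _ _ _ _ _ _) (src_mean _ _ _ _) => z1 z2 z3 z4 z5 z6.
by clear -e1; lra.
Qed.

End LowerBound.

(** * Monotonicity and convexity in the source intensity *)

Section Chord.
Variable R : realType.
Implicit Types (t z q : R).

Lemma src_mean_mono (s s' q : R) n T : 0 <= s -> s <= s' -> 0 <= q ->
  s' + n%:R * q <= 1 -> src_mean s q n T <= src_mean s' q n T.
Proof.
move=> s0 ss q0 h; rewrite /src_mean.
suff mono F : (forall u v, F (u ++ 0%N :: v) <= F (u ++ 1%N :: v)) ->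
    EW (letters s q n) T F <= EW (letters s' q n) T F.
  apply: mono => u v; rewrite ler_nat lnd_insert_lt //.
  by case/andP: (lnd_insert 1 u 1 v).
have l' : law (letters s' q n) by apply: letters_law => //; exact: le_trans ss.
have l1 : law (letters s q n) by apply: letters_law => //; lra.
elim: T F => [|T IH] F hF //=.
apply: (@le_trans _ _ (E1 (letters s q n) (fun x => EW (letters s' q n) T (fun w => F (x :: w))))).
  apply: (E1_le l1 (P := xpredT)) => [|x _]; first exact: E1_all.
  by apply: IH => u v; apply: (hF (x :: u)).
rewrite !E1_letters.
have : EW (letters s' q n) T (fun w => F (0%N :: w)) <= EW (letters s' q n) T (fun w => F (1%N :: w)).
  by apply: (EW_le l') => w; apply: (hF [::]).
move: (EW _ _ _) (EW _ _ _) (\sum_(_ <- _) _) => a b c ab.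
have := mulr_ge0 (_ : 0 <= s' - s) (_ : 0 <= a - b); rewrite !subr_ge0 => /(_ ss ab).
by clear; lra.
Qed.

(* [None] marks an optional source, kept with probability [t]. *)
Fixpoint keep t (v : seq (option nat)) (F : seq nat -> R) : R :=
  match v with
  | [::] => F [::]
  | Some x :: v' => keep t v' (fun w => F (x :: w))
  | None :: v' => (1 - t) * keep t v' (fun w => F (0%N :: w)) +
                  t * keep t v' (fun w => F (1%N :: w))
  end.

(** Sources of intensity [q] are always present, while marks of intensity [z] are thinned by
    [keep t]; the total intensity is [q + t * z]. *)
Definition marked z q n : seq (R * option nat) :=
  [:: (1 - q - z - n%:R * q, Some 0%N), (z, None), (q, Some 1%N)
    & [seq (q, Some i.+2) | i <- iota 0 n]].

Lemma keep_ext t v F G :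
  (forall w, (forall a, (1 < a)%N -> lnd a w = lnd a (map (odflt 0%N) v)) -> F w = G w) ->
  keep t v F = keep t v G.
Proof.
elim: v F G => [|[x|] v IH] F G h /=; first exact: h.
  by apply: IH => w hw; apply: h => a a1 /=; rewrite hw //; case: ifP => // /(leq_trans a1)/hw->.
congr (_ * _ + _ * _); apply: IH => w hw; apply: h => a a1 /=.
  by rewrite hw // leqNgt (ltn_trans _ a1).
by rewrite hw // leqNgt a1 leqNgt (ltn_trans _ a1).
Qed.

Lemma keep_EW t z q n T F :
  EW (marked z q n) T (fun v => keep t v F) = EW (letters (q + t * z) q n) T F.
Proof.
elim: T F => //= T IH F; rewrite E1_letters /E1 !big_cons big_map /=.
rewrite EWD !EWZ !IH -mulr_sumr.
under [in LHS]eq_bigr => i _ do rewrite IH.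
ring.
Qed.

Lemma lnd_marks a v : (1 < a)%N ->
  lnd a (map (odflt 1%N) v) = lnd a (map (odflt 0%N) v).
Proof.
elim: v a => //= -[x|] v IH a a1 /=.
  by rewrite IH //; case: ifP => // /(leq_trans a1)/IH->.
by rewrite IH // (leqNgt a 1) (leqNgt a 0) a1 (ltn_trans _ a1).
Qed.

(* The path length is [y |-> maxn (y + a) b] composed along the word, and such
   maps are convex in the number [y] of surviving sources. *)
Lemma keep_chord t v a b : 0 <= t <= 1 ->
  keep t v (fun w => (maxn (lnd 1 w + a) b)%:R) <=
  (1 - t) * (maxn (lnd 1 (map (odflt 0%N) v) + a) b)%:R +
  t * (maxn (lnd 1 (map (odflt 1%N) v) + a) b)%:R.
Proof.
move=> ht; have /andP[t0 t1] := ht.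
have cons0 w : lnd 1 (0%N :: w) = lnd 1 w by [].
have cons1 w : lnd 1 (1%N :: w) = (lnd 1 w).+1 by rewrite lnd_head.
have ext v' (F G : seq nat -> R) : F =1 G -> keep t v' F = keep t v' G.
  by move=> FG; apply: keep_ext => w _.
have kS x v' F : keep t (Some x :: v') F = keep t v' (fun w => F (x :: w)) by [].
have kN v' F : keep t (None :: v') F = (1 - t) * keep t v' (fun w => F (0%N :: w)) +
    t * keep t v' (fun w => F (1%N :: w)) by [].
have mS d x v' : map (odflt d) (Some x :: v') = x :: map (odflt d) v' by [].
have mN d v' : map (odflt d) (None :: v') = d :: map (odflt d) v' by [].
elim: v a b => [|[x|] v IH] a b.
- by rewrite /= -mulrDl subrK mul1r.
- rewrite kS !mS.
  case: x => [|[|x]].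
  + rewrite !cons0; exact: IH.
  + rewrite !cons1 !addSnnS; rewrite (ext _ _ (fun w => (maxn (lnd 1 w + a.+1) b)%:R)) //.
    by move=> w; rewrite cons1 addSnnS.
  (* A path from a row letter meets no source, so its length [l] is the same for every thinning and
     only raises the floor [b]. *)
  + pose l := (lnd x.+2 (map (odflt 0%N) v)).+1.
    have consx w : lnd x.+2 w = lnd x.+2 (map (odflt 0%N) v) ->
        maxn (lnd 1 (x.+2 :: w) + a) b = maxn (lnd 1 w + a) (maxn (l + a) b).
      by move=> e; rewrite /= e -/l; clear; lia.
    rewrite (consx (map (odflt 0%N) v) erefl).
    rewrite (consx _ (@lnd_marks x.+2 v isT)).
    rewrite (keep_ext _ (G := fun w => (maxn (lnd 1 w + a) (maxn (l + a) b))%:R)).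
      exact: IH.
    by move=> w hw; rewrite consx // hw.
- rewrite kN !mN cons0 cons1.
  rewrite (ext _ (fun w => (maxn (lnd 1 (1%N :: w) + a) b)%:R)
             (fun w => (maxn (lnd 1 w + a.+1) b)%:R)); last first.
    by move=> w; rewrite cons1 addSnnS.
  have h0 := IH a b; have h1 := IH a.+1 b.
  set y0 := lnd 1 (map (odflt 0%N) v) in h0 h1 *.
  set y1 := lnd 1 (map (odflt 1%N) v) in h0 h1 *.
  have y01 : (y0 <= y1)%N.
    rewrite /y0 /y1; clear.
    suff H c : (0 < c)%N ->
        (lnd c (map (odflt 0%N) v) <= lnd c (map (odflt 1%N) v))%N by apply: H.
    move: c.
    elim: v => //= -[x|] v IH c c0 /=; have h0 := IH _ c0; last first.
      by rewrite [(c <= 0)%N]leqNgt c0 /=; case: ifP; lia.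
    by case: ifP => // cx; have := IH x (leq_trans c0 cx); lia.
  have cvx : (maxn (y1 + a) b)%:R + (maxn (y0 + a.+1) b)%:R <=
     (maxn (y0 + a) b)%:R + (maxn (y1 + a.+1) b)%:R :> R.
    by rewrite -!natrD ler_nat; move: y01; clear; lia.
  rewrite addSnnS; move: cvx h0 h1.
  set A := keep _ _ _; set B := keep _ _ _.
  move: A B (_%:R) (_%:R) (_%:R) (_%:R) => A B u1 u2 u3 u4 cvx h0 h1.
  have t10 : 0 <= 1 - t by lra.
  have k0 := ler_wpM2l t10 h0; have k1 := ler_wpM2l t0 h1.
  have k2 := ler_wpM2l (mulr_ge0 t10 t0) cvx.
  by clear -k0 k1 k2; lra.
Qed.

(** All three intensities are thinnings of one marked word, over which [keep_chord] is averaged. *)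
Lemma src_mean_chord t z q n T : 0 <= t <= 1 -> 0 <= z -> 0 <= q ->
  q + z + n%:R * q <= 1 ->
  src_mean (q + t * z) q n T <=
  (1 - t) * src_mean q q n T + t * src_mean (q + z) q n T.
Proof.
move=> ht z0 q0 h.
have E u : src_mean (q + u * z) q n T =
    EW (marked z q n) T (fun v => keep u v (fun w => (maxn (lnd 1 w + 0) 0)%:R)).
  by rewrite keep_EW; apply: EW_eq => w; rewrite addn0 maxn0.
have lm : law (marked z q n).
  split.
    rewrite /= z0 q0 all_map; apply/andP; split; first lra.
    by apply/allP => i _ /=.
  rewrite /E1 !big_cons big_map /= -mulr_sumr big_const_seq count_predT size_iota.
  by rewrite iter_addr addr0 -[1 *+ n]/(n%:R); ring.
have E0 := E 0; rewrite mul0r addr0 in E0.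
have E1 := E 1; rewrite mul1r in E1.
rewrite E E0 E1 -!EWZ -EWD; apply: (EW_le lm) => v.
apply: le_trans (keep_chord _ _ _ ht) _.
have k0 w F : keep 0 w F = F (map (odflt 0%N) w).
  elim: w F => //= -[x|] w IH F /=; first exact: IH.
  by rewrite subr0 mul1r mul0r addr0 IH.
have k1 w F : keep 1 w F = F (map (odflt 1%N) w).
  elim: w F => //= -[x|] w IH F /=; first exact: IH.
  by rewrite subrr mul1r mul0r add0r IH.
by rewrite k0 k1.
Qed.

End Chord.

(** * Uniform random words *)

Section UniformWords.
Variable R : realType.
Implicit Types (q : R).

Definition unif n : seq (R * nat) := [seq (n%:R^-1, i) | i <- iota 0 n].

Definition word_mean n T : R := EW (unif n) T (fun w => (lnd 0 w)%:R).

Lemma E1_unif n f : E1 (unif n) f = n%:R^-1 * \sum_(i <- iota 0 n) f i.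
Proof. by rewrite /E1 big_map mulr_sumr. Qed.

Lemma unif_law n : law (unif n.+1).
Proof.
split; first by rewrite all_map; apply/allP => i _ /=; rewrite invr_ge0.
rewrite E1_unif big_const_seq count_predT size_iota iter_addr addr0.
by rewrite -[1 *+ _]/(n.+1%:R) mulVf // pnatr_eq0.
Qed.

Lemma word_mean_step n T :
  word_mean n.+1 T <= word_mean n.+1 T.+1 <= word_mean n.+1 T + 1.
Proof.
have lu := unif_law n.
rewrite {2 3}/word_mean /=; apply/andP; split.
  rewrite -(E1_cst lu (word_mean _ T)); apply: (E1_le lu (P := xpredT)) => [|x _].
    exact: E1_all.
  apply: (EW_le lu) => w; rewrite ler_nat.
  by case/andP: (lnd_insert 0 [::] x w).
rewrite -(E1_cst lu (_ + 1)); apply: (E1_le lu (P := xpredT)) => [|x _].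
  exact: E1_all.
rewrite -[X in _ <= _ + X](EW_cst lu T 1) -EWD; apply: (EW_le lu) => w; rewrite natr1 ler_nat.
by case/andP: (lnd_insert 0 [::] x w).
Qed.

Lemma word_mean_lipschitz n a b :
  word_mean n.+1 a <= word_mean n.+1 b + Num.max (a%:R - b%:R) 0.
Proof.
have mono d : word_mean n.+1 a <= word_mean n.+1 (a + d).
  elim: d => [|d IH]; first by rewrite addn0.
  by rewrite addnS; apply: le_trans IH _; case/andP: (word_mean_step n (a + d)).
have lip d : word_mean n.+1 (b + d) <= word_mean n.+1 b + d%:R.
  elim: d => [|d IH]; first by rewrite addn0 addr0.
  rewrite addnS -natr1 addrA.
  by case/andP: (word_mean_step n (b + d)) => _ /le_trans; apply; rewrite lerD2r.
have [ab|ba] := leqP a b.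
  have := mono (b - a)%N; rewrite subnKC // => /le_trans; apply.
  by rewrite lerDl le_max lexx orbT.
have := lip (a - b)%N; rewrite (subnKC (ltnW ba)) natrB ?(ltnW ba) // => /le_trans; apply.
by rewrite lerD2l le_max lexx.
Qed.

Definition support (w : seq nat) : nat := count (fun x => 0 < x)%N w.

(** Given their number, the nonblank letters are independent and uniform, and [F] ignores the
    blanks. *)
Lemma EW_blank q n T (F : seq nat -> R) :
  (forall u v, F (u ++ 0%N :: v) = F (u ++ v)) ->
  EW (letters q q n) T F = EW (letters q q n) T
    (fun w => EW [seq (n.+1%:R^-1, i.+1) | i <- iota 0 n.+1] (support w) F).
Proof.
set mu := [seq _ | _ <- _].
have E1mu f : E1 mu f = n.+1%:R^-1 * (f 1%N + \sum_(i <- iota 0 n) f i.+2).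
  rewrite /E1 /mu big_map -mulr_sumr /= big_cons.
  by rewrite (iotaDl 1 0) big_map.
have E1l f : E1 (letters q q n) f =
    (1 - q - n%:R * q) * f 0%N + n.+1%:R * q * E1 mu f.
  rewrite E1_letters E1mu [n.+1%:R * q]mulrC -[in RHS]mulrA mulVKf ?pnatr_eq0 //.
  by rewrite mulrDr addrA.
elim: T F => [|T IH] F hF //.
have hFx x u v : F (x :: u ++ 0%N :: v) = F (x :: u ++ v) by apply: (hF (x :: u)).
rewrite -[LHS]/(E1 (letters q q n) (fun x => EW (letters q q n) T (fun w => F (x :: w)))) E1l.
rewrite -[RHS]/(E1 (letters q q n) (fun x => EW (letters q q n) T
   (fun w => EW mu (support (x :: w)) F))) E1l; cbv beta.
have -> : EW (letters q q n) T (fun w => F (0%N :: w)) = EW (letters q q n) T F.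
  by apply: EW_eq => w; apply: (hF [::]).
have -> : E1 mu (fun x => EW (letters q q n) T (fun w => F (x :: w))) =
  E1 mu (fun x => EW (letters q q n) T (fun w => EW mu (support w) (fun v => F (x :: v)))).
  by apply: E1_eq => x; apply: (IH (fun w => F (x :: w))) => u v; apply: hFx.
rewrite -EW_E1 IH //; congr (_ * _ + _ * _).
rewrite E1mu; cbv beta; rewrite (eq_bigr (fun _ => EW (letters q q n) T (fun w => EW mu (support w).+1 F))) //.
rewrite big_const_seq count_predT size_iota iter_addr addr0.
set X := EW _ _ (fun w => EW mu _ _).
by rewrite -mulrS -[X *+ _]mulr_natl mulKf // pnatr_eq0.
Qed.

(** At intensity [q] the sources form one more row below the others, hence the alphabet size
    [n.+1]. *)
Lemma src_mean_words q n T :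
  src_mean q q n T = EW (letters q q n) T (fun w => word_mean n.+1 (support w)).
Proof.
rewrite /src_mean (@EW_blank q n T (fun w => (lnd 1 w)%:R)); last first.
  by move=> u v; rewrite lnd_insert_lt.
apply: EW_eq => w; rewrite /word_mean.
have -> : [seq (n.+1%:R^-1, i.+1) | i <- iota 0 n.+1] =
    [seq (a.1, a.2.+1) | a <- unif n.+1] :> seq (R * nat).
  by rewrite /unif -map_comp.
rewrite -EW_map; apply: EW_eq => v; congr _%:R.
by apply: lnd_map_mono.
Qed.

(** Inequality of arithmetic and geometric means with a free parameter [kap]: it bounds an expected
    excess by a variance without square roots. *)
Lemma pos_part_le (x y kap : R) : 0 < kap -> x <= y ->
  Num.max x 0 <= (y ^+ 2 / kap + kap) / 2.
Proof.
move=> k0 xy.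
have h : 0 <= (y ^+ 2 / kap + kap) / 2 - y.
  have -> : (y ^+ 2 / kap + kap) / 2 - y = (y - kap) ^+ 2 / (2 * kap).
    by field; rewrite gt_eqF.
  by rewrite divr_ge0 ?sqr_ge0 // mulr_ge0 // ltW.
have h2 : 0 <= (y ^+ 2 / kap + kap) / 2.
  by rewrite divr_ge0 // addr_ge0 ?divr_ge0 ?sqr_ge0 // ltW.
by rewrite ge_max h2 andbT; lra.
Qed.

Section Compare.
Variables (q kap : R) (n T T' : nat).
Hypotheses (q0 : 0 <= q) (hq : n.+1%:R * q <= 1) (k0 : 0 < kap).
Let b := n.+1%:R * q.
Let hl : law (letters q q n).
Proof. by apply: letters_law => //; move: hq; rewrite -natr1; lra. Qed.

Let bE : E1 (letters q q n) (fun x => (0 < x)%:R) = b.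
Proof.
rewrite E1_letters /= big_const_seq count_predT size_iota iter_addr addr0 /b -natr1.
by rewrite -[1 *+ n]/(n%:R); ring.
Qed.

Let var : EW (letters q q n) T' (fun w => ((support w)%:R - T'%:R * b) ^+ 2) =
  T'%:R * (b * (1 - b)).
Proof.
have sE w : (support w)%:R = \sum_(x <- w) (0 < x)%:R :> R.
  by rewrite /support; elim: w => [|x w IH] /=; rewrite ?big_nil ?big_cons // natrD IH.
under EW_eq => w do rewrite sE.
rewrite (EW_var hl _ bE) E1_letters /=.
rewrite (eq_bigr (fun _ => (1 - b) ^+ 2)) // big_const_seq count_predT size_iota.
rewrite iter_addr addr0 -mulr_natl /b -natr1; congr (_ * _); ring.
Qed.

Lemma word_mean_le_src : T%:R <= T'%:R * b ->
  word_mean n.+1 T <= src_mean q q n T' + (T'%:R * (b * (1 - b)) / kap + kap) / 2.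
Proof.
move=> hT; rewrite -var src_mean_words.
rewrite -(EW_cst hl T' (word_mean _ _)) -[X in (_ + X) / 2](EW_cst hl T' kap).
rewrite ![_ / _]mulrC -EWZ -EWD -EWZ -EWD; apply: (EW_le hl) => w.
apply: le_trans (word_mean_lipschitz _ _ (support w)) _; rewrite lerD2l.
rewrite mulrC [kap^-1 * _]mulrC -[(_ - _) ^+ 2]sqrrN opprB.
by apply: pos_part_le => //; rewrite lerB.
Qed.

Lemma src_le_word_mean : T'%:R * b <= T%:R ->
  src_mean q q n T' <= word_mean n.+1 T + (T'%:R * (b * (1 - b)) / kap + kap) / 2.
Proof.
move=> hT; rewrite -var src_mean_words.
rewrite -(EW_cst hl T' (word_mean _ _)) -[X in (_ + X) / 2](EW_cst hl T' kap).
rewrite ![_ / _]mulrC -EWZ -EWD -EWZ -EWD; apply: (EW_le hl) => w.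
apply: le_trans (word_mean_lipschitz _ _ T) _; rewrite lerD2l.
rewrite mulrC [kap^-1 * _]mulrC.
by apply: pos_part_le => //; rewrite lerB.
Qed.
End Compare.

End UniformWords.

(** * Explicit two-sided bounds for uniform words *)

Section UlamBounds.
Variable R : realType.

(* Parametrisation [alpha = 1 + x] of the source intensity. *)
Lemma src_mean_le_param (x q : R) n T : 0 < x -> 0 <= q ->
  (1 + x + n%:R) * q <= 1 ->
  src_mean ((1 + x) * q) q n T <= T%:R * ((1 + x) * q) + n%:R / x.
Proof.
move=> x0 q0 h; have x1 : 0 < 1 + x by lra.
have hp : 0 < (1 + x)^-1 < 1 by rewrite invr_gt0 x1 invf_lt1 //; lra.
have := @src_mean_le R (1 + x)^-1 q n T hp q0; rewrite invrK => /(_ h).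
have -> : (1 + x)^-1 / (1 - (1 + x)^-1) = x^-1.
  have -> : 1 - (1 + x)^-1 = x / (1 + x) by field; rewrite gt_eqF.
  by field; rewrite !gt_eqF.
by [].
Qed.

Lemma src_mean_ge_param (x y q e : R) n T
    (g := (T%:R * ((1 + x) * q) + n%:R / x) - (T%:R * ((1 + y) * q) + n%:R / y)) :
  0 < y -> y < x -> 0 <= q -> (1 + x + n%:R) * q <= 1 -> 0 < g -> 0 < e ->
  T%:R * ((1 + x) * q) + n%:R / x - 2
  - e * (n%:R * (2 + x) / x ^+ 2 + (n%:R / x) ^+ 2)
  - 2 / (e * g ^+ 2) * (2 * (T%:R * ((1 + x) * q)) + 2 * (n%:R * (2 + x) / x ^+ 2) +
       (2 * (T%:R * ((1 + y) * q)) + 2 * (n%:R * (2 + y) / y ^+ 2)) + 2)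
  <= src_mean ((1 + x) * q) q n T.
Proof.
move=> y0 yx q0 h g0 e0; have x0 : 0 < x by apply: lt_trans yx.
have x1 : 0 < 1 + x by lra. have y1 : 0 < 1 + y by lra.
have k1 z : 0 < z -> (1 + z)^-1 / (1 - (1 + z)^-1) = z^-1 :> R.
  move=> z0; have z1 : 1 + z != 0 by rewrite gt_eqF; lra.
  have -> : 1 - (1 + z)^-1 = z / (1 + z) by field.
  by field; rewrite z1 gt_eqF.
have k2 z : 0 < z ->
    n%:R * ((1 + z)^-1 * (1 + (1 + z)^-1) / (1 - (1 + z)^-1) ^+ 2) =
    n%:R * (2 + z) / z ^+ 2 :> R.
  move=> z0; have z1 : 1 + z != 0 by rewrite gt_eqF; lra.
  have -> : 1 - (1 + z)^-1 = z / (1 + z) by field.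
  by field; rewrite z1 gt_eqF.
have := @src_mean_ge R (1 + x)^-1 (1 + y)^-1 q n T e.
rewrite !invrK (k1 _ x0) (k1 _ y0) (k2 _ x0) (k2 _ y0); apply => //.
- by rewrite invr_gt0.
- by rewrite ltf_pV2 ?posrE //; lra.
- by rewrite invf_lt1 //; lra.
Qed.

Lemma word_mean_upper n T (d : R) (s : R := Num.sqrt T%:R) : (0 < T)%N -> 0 < d ->
  word_mean R n.+1 T <=
  T%:R / n.+1%:R + 2 * s + 1 + ((s + 1) / (d * s) + d * s) / 2.
Proof.
move=> T0 d0; have s0 : 0 < s by rewrite sqrtr_gt0 ltr0n.
have sT : T%:R = s ^+ 2 :> R by rewrite sqr_sqrtr.
set N : R := n.+1%:R; have N0 : 0 < N by rewrite ltr0n.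
have NE : n%:R = N - 1 by rewrite /N -natr1 addrK.
have n0 : 0 <= n%:R :> R by [].
(* The optimal excess [sqrt (N / k)] of the source intensity, for [k = T / N]. *)
pose r : R := N / s; have r0 : 0 < r by rewrite divr_gt0.
(* With this [q], the [n] rows and sources of intensity [(1 + r) * q] leave no blank. *)
pose q : R := (N + r)^-1; have q0 : 0 < q by rewrite invr_gt0 addr_gt0.
have qE : (N + r) * q = 1 by rewrite mulfV // gt_eqF // addr_gt0.
have rs : r * s = N by rewrite /r divfK // gt_eqF.
(* Enough columns for the mean number [T' * (N * q)] of letters to reach [T], since
   [s ^+ 2 + s = k * (N + r)]. *)
pose T' := (Num.truncn (s ^+ 2 + s)).+1.
have T1 : s ^+ 2 + s < T'%:R by rewrite truncnS_gt.
have T2 : T'%:R <= s ^+ 2 + s + 1.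
  by rewrite -natr1 lerD2r truncn_le // addr_ge0 ?sqr_ge0 // ltW.
have q0' : 0 <= q := ltW q0.
have Nq1 : N * q <= 1 by rewrite -[X in _ <= X]qE; apply: ler_wpM2r => //; lra.
(* [k = T / N] is the mean number of points per row *)
pose k : R := s ^+ 2 / N.
have kN : k * N = s ^+ 2 by rewrite /k divfK // gt_eqF.
have kr : k * r = s.
  by apply: (mulIf (lt0r_neq0 s0)); rewrite -mulrA rs kN expr2.
have tau : T'%:R * q <= k + q.
  have -> : k + q = (s ^+ 2 + s + 1) * q.
    have -> : s ^+ 2 + s = k * (N + r) by rewrite mulrDr kN kr.
    by rewrite mulrDl mul1r -mulrA qE mulr1.
  by apply: ler_wpM2r.
have tau2 : k <= T'%:R * q.
  have -> : k = (s ^+ 2 + s) * q.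
    have -> : s ^+ 2 + s = k * (N + r) by rewrite mulrDr kN kr.
    by rewrite -mulrA qE mulr1.
  by apply: ler_wpM2r => //; apply: ltW.
have rq : r * q <= 1 by rewrite -[X in _ <= X]qE; apply: ler_wpM2r => //; lra.
have rq0 : 0 <= r * q by rewrite mulr_ge0 // ltW.
have N1 : 1 <= N by rewrite ler1n.
have q1 : (1 + r) * q <= 1.
  by rewrite -[X in _ <= X]qE; apply: ler_wpM2r => //; lra.
have kap0 : 0 < d * s by rewrite mulr_gt0.
have := @word_mean_le_src R q (d * s) n T T' (ltW q0) Nq1 kap0.
rewrite -/N sT.
have -> : s ^+ 2 <= T'%:R * (N * q).
  rewrite -kN mulrCA mulrC; apply: ler_wpM2l tau2; exact: ltW.
move=> /(_ isT) /le_trans; apply.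
have h1 : src_mean q q n T' <= src_mean ((1 + r) * q) q n T'.
  have := @src_mean_mono R q ((1 + r) * q) q n T'.
  apply=> //; first by rewrite mulrDl mul1r; lra.
  by rewrite -mulrDl NE -[X in _ <= X]qE; apply: ler_wpM2r => //; lra.
have h2 := @src_mean_le_param r q n T' r0 (ltW q0).
have {}h2 : src_mean ((1 + r) * q) q n T' <= T'%:R * ((1 + r) * q) + n%:R / r.
  by apply: h2; rewrite NE -[X in _ <= X]qE; apply: ler_wpM2r => //; lra.
have h3 : T'%:R * ((1 + r) * q) <= k + s + 1.
  have -> : T'%:R * ((1 + r) * q) = (1 + r) * (T'%:R * q) by ring.
  have r1 : 0 <= 1 + r by lra.
  apply: le_trans (ler_wpM2l r1 tau) _.
  by rewrite mulrDr mulrDl mul1r [r * k]mulrC kr; lra.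
have h4 : n%:R / r <= s.
  rewrite ler_pdivrMr // NE mulrC rs; lra.
have h5 : T'%:R * (N * q * (1 - N * q)) / (d * s) <= (s + 1) / (d * s).
  apply: ler_wpM2r; first by rewrite invr_ge0 ltW.
  have -> : 1 - N * q = r * q by rewrite -qE; ring.
  have -> : T'%:R * (N * q * (r * q)) = (N * q) * (r * (T'%:R * q)) by ring.
  have a1 : r * (T'%:R * q) <= s + 1.
    apply: le_trans (ler_wpM2l (ltW r0) tau) _; rewrite mulrDr [r * k]mulrC kr; lra.
  have a0 : 0 <= r * (T'%:R * q) by apply: mulr_ge0; [exact: ltW | exact: mulr_ge0].
  apply: le_trans a1; apply: ler_piMl => //.
rewrite -/k.
move: h1 h2 h3 h4 h5; set u1 := _ / (d * s); set u2 := _ / (d * s).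
move: (src_mean _ _ _ _) (src_mean _ _ _ _) (T'%:R * _) (_ / r) => v1 v2 v3 v4.
by clear; lra.
Qed.

(** The stationary value at excess [a * r] is about [k + s * (a + a^-1)]. Its chord through
    [a1 = 1 + d] and [a2 = 1 + 2 * d], prolonged to [a = 0], takes the value
    [k + s * (a1^-1 + a2^-1)], which is [k + 2 * s] up to [3 * d * s]. Convexity places the true
    value at [a = 0] above it; the factor [2 / d] is the price of the extrapolation. *)
Lemma word_mean_lower n T (d e : R) (s : R := Num.sqrt T%:R)
    (N : R := n.+1%:R) (k : R := T%:R / N) :
  (0 < T)%N -> 0 < d -> d <= 1 / 2 -> 0 < e -> 4 <= d * s ->
  k + 2 * s - (3 * d * s + 2 * (s / N) + 1 +
    2 / d * (2 + e / s * (2 * k + s + s ^+ 2) +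
             32 / (e * d ^+ 4 * s) * (12 * k + 10 * s + 2)) +
    (2 * s / (d * s) + d * s) / 2) <= word_mean R n.+1 T.
Proof.
move=> T0 d0 d1 e0 ds; have s0 : 0 < s by rewrite sqrtr_gt0 ltr0n.
have sT : T%:R = s ^+ 2 :> R by rewrite sqr_sqrtr.
have N0 : 0 < N by rewrite ltr0n.
have NE : n%:R = N - 1 by rewrite /N -natr1 addrK.
have n0 : 0 <= n%:R :> R by [].
pose r : R := N / s; have r0 : 0 < r by rewrite divr_gt0.
have rs : r * s = N by rewrite /r divfK // gt_eqF.
pose a1 : R := 1 + d; pose a2 : R := 1 + 2 * d.
have a10 : 0 < a1 by rewrite /a1; lra.
have a20 : 0 < a2 by rewrite /a2; lra.
have a22 : a2 <= 2 by rewrite /a2; lra.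
have a12 : a2 - a1 = d by rewrite /a1 /a2; ring.
have a1r : 0 < a1 * r by rewrite mulr_gt0.
have a2r : 0 < a2 * r by rewrite mulr_gt0.
have ra1 : r < a1 * r by rewrite ltr_pMl // /a1; lra.
have ra2 : a1 * r <= a2 * r by rewrite ler_pM2r // /a1 /a2; lra.
(* Normalised by the largest source intensity in use, at excess [a2 * r], which leaves no blank. *)
pose q : R := (N + a2 * r)^-1; have q0 : 0 < q by rewrite invr_gt0 addr_gt0.
have q0' : 0 <= q := ltW q0.
have qE : (N + a2 * r) * q = 1 by rewrite mulfV // gt_eqF // addr_gt0.
(* Rounded down: the mean number of letters must now stay below [T]. *)
pose T' := Num.truncn (s ^+ 2 + a2 * s).
have pos : 0 <= s ^+ 2 + a2 * s by rewrite addr_ge0 ?sqr_ge0 // mulr_ge0 // ltW.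
have T1 : T'%:R <= s ^+ 2 + a2 * s by rewrite truncn_le.
have T2 : s ^+ 2 + a2 * s - 1 <= T'%:R.
  by rewrite lerBlDr natr1 ltW // truncnS_gt.
have kE : k = s ^+ 2 / N by rewrite /k sT.
have k0 : 0 <= k by rewrite kE divr_ge0 ?sqr_ge0 // ltW.
have kN : k * N = s ^+ 2 by rewrite kE divfK // gt_eqF.
have kr : k * r = s.
  by apply: (mulIf (lt0r_neq0 s0)); rewrite -mulrA rs kN expr2.
have sk : s ^+ 2 + a2 * s = k * (N + a2 * r) by rewrite mulrDr kN mulrCA kr.
set tau : R := T'%:R * q.
have tau0 : 0 <= tau by rewrite mulr_ge0.
have tau1 : tau <= k.
  have -> : k = (s ^+ 2 + a2 * s) * q by rewrite sk -mulrA qE mulr1.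
  exact: ler_wpM2r.
have tau2 : k - q <= tau.
  have -> : k - q = (s ^+ 2 + a2 * s - 1) * q.
    by rewrite mulrBl sk -mulrA qE mulr1 mul1r.
  exact: ler_wpM2r.
have N1 : 1 <= N by rewrite ler1n.
have le_q c : c <= N + a2 * r -> c * q <= 1.
  by move=> h; rewrite -[X in _ <= X]qE; apply: ler_wpM2r.
have q1 : q <= 1 by rewrite -[X in X <= _]mul1r; apply: le_q; lra.
have rq : r * q <= 1 by apply: le_q; lra.
have taur : s - 1 <= tau * r.
  by have := ler_wpM2r (ltW r0) tau2; rewrite mulrBl kr [q * r]mulrC; lra.
pose m : R := n%:R / r.
have mE : m = s - s / N.
  have rn := lt0r_neq0 r0; apply: (mulIf rn).
  by rewrite /m divfK // mulrBl mulrAC [s * r]mulrC rs divff ?lt0r_neq0 // NE.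
have sN0 : 0 <= s / N by rewrite divr_ge0 // ltW.
have m0 : 0 <= m by rewrite divr_ge0 // ltW.
have ms : m <= s by rewrite mE gerBl.
have ndiv c : n%:R / (c * r) = m / c by rewrite /m invfM; ring.
have tauE : tau = T'%:R * q by [].
have a1E : a1 = 1 + d by []. have a2E : a2 = 1 + 2 * d by [].
have mE0 : m = n%:R / r by [].
have NN : n.+1%:R = N by [].
clearbody tau m a1 a2 q r k N s.
pose fx : R := src_mean ((1 + a1 * r) * q) q n T'.
pose f2 : R := src_mean ((1 + a2 * r) * q) q n T'.
pose f1 : R := src_mean q q n T'.
have hf2 : f2 <= tau * (1 + a2 * r) + m / a2.
  have := @src_mean_le_param (a2 * r) q n T' a2r q0'.
  have -> : T'%:R * ((1 + a2 * r) * q) = tau * (1 + a2 * r) by rewrite tauE; ring.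
  rewrite ndiv; apply.
  by apply: le_q; rewrite NE; lra.
have chord : a2 * fx <= d * f1 + a1 * f2.
  have t01 : 0 <= a1 / a2 <= 1.
    by rewrite divr_ge0 ?ler_pdivrMr ?mul1r ?ltW //=; lra.
  have z0 : 0 <= q * (a2 * r) by rewrite mulr_ge0 // ltW.
  have := @src_mean_chord R (a1 / a2) (q * (a2 * r)) q n T' t01 z0 q0'.
  have -> : q + q * (a2 * r) = (1 + a2 * r) * q by ring.
  have -> : q + a1 / a2 * (q * (a2 * r)) = (1 + a1 * r) * q.
    by field; rewrite gt_eqF.
  have hq : (1 + a2 * r) * q + n%:R * q <= 1.
    by rewrite -mulrDl; apply: le_q; rewrite NE; lra.
  move=> /(_ hq) h; have := ler_wpM2l (ltW a20) h.
  have -> : a2 * ((1 - a1 / a2) * src_mean q q n T' + a1 / a2 * src_mean ((1 + a2 * r) * q) q n T')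
     = (a2 - a1) * f1 + a1 * f2.
    by rewrite -/f1 -/f2; field; rewrite gt_eqF.
  by rewrite a12.
pose g : R := (T'%:R * ((1 + a1 * r) * q) + n%:R / (a1 * r)) - (T'%:R * ((1 + r) * q) + n%:R / r).
have a1inv : 1 - a1^-1 = d / a1.
  have -> : d = a1 - 1 by clear -a1E; lra.
  by rewrite mulrBl mulfV ?lt0r_neq0 // mul1r.
have gE : g = d * (tau * r) - m * (d / a1).
  rewrite /g !ndiv -mE0 -a1inv tauE a1E; ring.
have a132 : a1 <= 3 / 2 by clear -a1E d1; lra.
(* At the optimum [r] the first-order terms cancel, which leaves a gap of order [d ^+ 2 * s];
   [4 <= d * s] absorbs the rounding of [T']. *)
have g1 : d ^+ 2 * s / 4 <= g.
  rewrite gE; have := ler_wpM2l (ltW d0) taur.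
  have da : 0 <= d / a1 by rewrite divr_ge0 ?ltW.
  have := ler_wpM2r da ms.
  have e1 : s * (d / a1) = d * s - d * s * (d / a1).
    have -> : d * s * (d / a1) = d * s - d * s * a1^-1 by rewrite -a1inv; ring.
    ring.
  have e2 : d * (2 / 3) <= d / a1.
    rewrite ler_pM2l // -[2 / 3]invrK lef_pV2 ?posrE ?invr_gt0 //; last lra.
    by rewrite invf_div.
  have ds0 : 0 <= d * s by rewrite mulr_ge0 ?ltW.
  have e3 := ler_wpM2l ds0 e2.
  have e4 := ler_wpM2l (ltW d0) ds.
  have -> : d ^+ 2 * s / 4 = d * (d * s) / 4 by ring.
  rewrite e1; clear -e3 e4 d0; lra.
have g0 : 0 < g.
  by apply: lt_le_trans g1; rewrite divr_gt0 // mulr_gt0 // exprn_gt0.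
(* The weight [eta] is [e / s] because the squared sink total is of order [s ^+ 2] and its cost
   should be of order [e * s]. *)
have es0 : 0 < e / s by rewrite divr_gt0.
have := @src_mean_ge_param (a1 * r) r q (e / s) n T' r0 ra1 q0' _ g0 es0.
rewrite -/g ndiv -/fx.
have -> : T'%:R * ((1 + a1 * r) * q) = tau * (1 + a1 * r) by rewrite tauE; ring.
have -> : T'%:R * ((1 + r) * q) = tau * (1 + r) by rewrite tauE; ring.
have hq2 : (1 + a1 * r + n%:R) * q <= 1.
  by apply: le_q; rewrite NE; clear -ra2; lra.
move=> /(_ hq2) hfx.
have var z : r <= z -> n%:R * (2 + z) / z ^+ 2 <= 2 * k + s.
  move=> rz; have z0 : 0 < z by apply: lt_le_trans rz.
  rewrite ler_pdivrMr ?exprn_gt0 //.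
  have b1 : s * r <= s * z by rewrite ler_pM2l.
  have b2 : k * r * r <= k * z * z.
    by apply: ler_pM; rewrite ?mulr_ge0 ?(ltW r0) //; apply: ler_wpM2l.
  have b3 := ler_wpM2r (ltW z0) b1.
  rewrite kr in b2; rewrite [s * r]mulrC rs in b1 b2 b3.
  have b4 : n%:R * z <= N * z by apply: ler_wpM2r; [exact: ltW | rewrite NE gerBl].
  have -> : (2 * k + s) * z ^+ 2 = 2 * (k * z * z) + s * z * z by ring.
  by clear -b2 b3 b4 NE; lra.
have v1 := var _ (ltW ra1); have v2 := var _ (lexx r).
have m2 : (m / a1) ^+ 2 <= s ^+ 2.
  have h : m / a1 <= m by rewrite ler_pdivrMr // ler_peMr //; clear -a1E d0; lra.
  apply: lerXn2r; rewrite ?nnegrE; [by rewrite divr_ge0 // ltW | exact: ltW|].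
  exact: le_trans ms.
have t1 : tau * (1 + a1 * r) <= k + 2 * s.
  have h0 : 0 <= 1 + a1 * r by apply: addr_ge0 => //; exact: ltW.
  apply: le_trans (ler_wpM2r h0 tau1) _.
  rewrite mulrDr mulr1 mulrCA kr lerD2l.
  by apply: ler_wpM2r; [exact: ltW | clear -a132; lra].
have t2 : tau * (1 + r) <= k + s.
  have h0 : 0 <= 1 + r by apply: addr_ge0 => //; exact: ltW.
  apply: le_trans (ler_wpM2r h0 tau1) _.
  by rewrite mulrDr mulr1 kr.
set W : R := 12 * k + 10 * s + 2.
have W0 : 0 <= W by clear -k0 s0; rewrite /W; lra.
set E : R := 2 + e / s * (2 * k + s + s ^+ 2) + 32 / (e * d ^+ 4 * s) * W.
have hx : tau * (1 + a1 * r) + m / a1 - E <= fx.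
  apply: le_trans hfx; rewrite /E.
  have u1 := ler_wpM2l (ltW es0) (lerD v1 m2).
  have u2 : 2 / (e / s * g ^+ 2) <= 32 / (e * d ^+ 4 * s).
    have h1 : (d ^+ 2 * s / 4) ^+ 2 <= g ^+ 2.
      apply: lerXn2r g1; rewrite nnegrE; last exact: ltW.
      by rewrite divr_ge0 // mulr_ge0 ?sqr_ge0 // ltW.
    have h2 := ler_wpM2l (ltW es0) h1.
    have -> : 32 / (e * d ^+ 4 * s) = 2 / (e / s * (d ^+ 2 * s / 4) ^+ 2).
      by field; rewrite !gt_eqF.
    rewrite ler_pM2l ?ltr0n // lef_pV2 // posrE mulr_gt0 // exprn_gt0 //.
    by rewrite divr_gt0 // mulr_gt0 // exprn_gt0.
  have c0 : 0 <= 2 / (e / s * g ^+ 2).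
    by rewrite divr_ge0 // mulr_ge0 ?sqr_ge0 // ltW.
  have u3 : forall w, w <= W -> 2 / (e / s * g ^+ 2) * w <= 32 / (e * d ^+ 4 * s) * W.
    move=> w wW; apply: le_trans (ler_wpM2l c0 wW) _; exact: ler_wpM2r.
  set w := (X in 2 / (e / s * g ^+ 2) * X).
  have wW : w <= W by rewrite /w /W; clear -t1 t2 v1 v2; lra.
  have {u3} := u3 w wW; clear -u1; lra.
have hf1 : tau + m * (2 - 3 * d) - 2 / d * E <= f1.
  have E0 : 0 <= E.
    rewrite /E; apply: addr_ge0; first apply: addr_ge0 => //.
      apply: mulr_ge0; first exact: ltW.
      by clear -k0 s0; have := sqr_ge0 s; lra.
    by apply: mulr_ge0 => //; rewrite divr_ge0 // ltW // mulr_gt0 // mulr_gt0 // exprn_gt0.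
  rewrite -(ler_pM2l d0).
  have -> : d * (tau + m * (2 - 3 * d) - 2 / d * E) = d * tau + m * (d * (2 - 3 * d)) - 2 * E.
    by field; rewrite gt_eqF.
  have i1 : d * (2 - 3 * d) <= a2 / a1 - a1 / a2.
    have -> : a2 / a1 - a1 / a2 = d * (a1^-1 + a2^-1).
      by rewrite -a12; field; rewrite !gt_eqF.
    rewrite ler_pM2l //.
    have j1 : 1 - d <= a1^-1.
      by rewrite -[a1^-1]mul1r ler_pdivlMr // a1E; have := sqr_ge0 d; clear; nra.
    have j2 : 1 - 2 * d <= a2^-1.
      by rewrite -[a2^-1]mul1r ler_pdivlMr // a2E; have := sqr_ge0 d; clear; nra.
    by move: j1 j2; clear; lra.
  have i2 := ler_wpM2l m0 i1.
  have i3 := ler_wpM2l (ltW a20) hx.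
  have i4 := ler_wpM2l (ltW a10) hf2.
  have i5 := ler_wpM2r E0 a22.
  have i6 : a2 * (tau * (1 + a1 * r) + m / a1 - E) - a1 * (tau * (1 + a2 * r) + m / a2)
     = d * tau + m * (a2 / a1 - a1 / a2) - a2 * E.
    by rewrite -a12; field; rewrite !gt_eqF.
  by clear -chord i2 i3 i4 i5 i6; lra.
have kap0 : 0 < d * s by rewrite mulr_gt0.
have Nq1 : N * q <= 1 by apply: le_q; rewrite lerDl ltW.
have Nq1' : n.+1%:R * q <= 1 by rewrite NN.
have := @src_le_word_mean R q (d * s) n T T' q0' Nq1' kap0.
rewrite NN sT.
have -> : T'%:R * (N * q) <= s ^+ 2.
  rewrite -kN mulrCA -tauE mulrC; apply: ler_wpM2r tau1; exact: ltW.
move=> /(_ isT); rewrite -/f1.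
have h5 : T'%:R * (N * q * (1 - N * q)) / (d * s) <= 2 * s / (d * s).
  apply: ler_wpM2r; first by rewrite invr_ge0 ltW.
  have -> : 1 - N * q = a2 * (r * q) by rewrite -[X in X - _]qE; ring.
  have -> : T'%:R * (N * q * (a2 * (r * q))) = (N * q) * (a2 * (tau * r)).
    by rewrite tauE; ring.
  have c1 : tau * r <= s by rewrite -kr; apply: ler_wpM2r => //; exact: ltW.
  have c0 : 0 <= tau * r by rewrite mulr_ge0 // ltW.
  apply: (@le_trans _ _ (a2 * (tau * r))).
    by apply: ler_piMl => //; apply: mulr_ge0 => //; exact: ltW.
  by apply: ler_pM => //; exact: ltW.
have mm : 2 * s - 3 * d * s - 2 * (s / N) <= m * (2 - 3 * d).
  by rewrite mE; have := mulr_ge0 (ltW d0) sN0; clear; lra.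
move: h5; set u1 := _ / (d * s); set u2 := _ / (d * s).
move: hf1 mm tau2 q1; rewrite -/E; clear; lra.
Qed.

End UlamBounds.

(** * Asymptotics of the mean for uniform words *)

Section Asymptotics.
Variable R : realType.

Lemma nat_above (x : R) : exists N0 : nat, forall n, (N0 <= n)%N -> x <= n%:R.
Proof.
exists (Num.truncn x).+1 => n h; apply: le_trans (ltW (truncnS_gt x)) _.
by rewrite ler_nat.
Qed.

Lemma sqrt_above (x : R) : exists N0 : nat, forall n, (N0 <= n)%N ->
  x <= Num.sqrt n%:R.
Proof.
have [N0 h] := nat_above (x ^+ 2); exists N0 => n /h hn.
have [x0|x0] := leP x 0; first exact: le_trans (sqrtr_ge0 _).
by rewrite -(ger0_norm (ltW x0)) -sqrtr_sqr ler_wsqrtr.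
Qed.

Lemma upper_error (d s : R) : 0 < d -> 1 <= s -> 2 * (1 + d^-1) / d <= s ->
  1 + ((s + 1) / (d * s) + d * s) / 2 <= d * s.
Proof.
move=> d0 s1 h; have s0 : 0 < s by lra.
have h1 : (s + 1) / (d * s) <= 2 / d.
  rewrite ler_pdivrMr ?mulr_gt0 // mulrA divfK ?lt0r_neq0 //; lra.
have h2 : 2 * (1 + d^-1) <= d * s by rewrite -ler_pdivrMl // mulrC.
lra.
Qed.

Lemma lower_error (d s y k C : R) : 0 < d -> d <= 1 / 2 -> 1 <= s -> 0 <= y ->
  k = s ^+ 2 * y -> C = 10 + 5 / d + 768 / d ^+ 7 ->
  3 * d * s + 2 * (s * y) + 1 +
    2 / d * (2 + d ^+ 2 / s * (2 * k + s + s ^+ 2) +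
             32 / (d ^+ 2 * d ^+ 4 * s) * (12 * k + 10 * s + 2)) +
    (2 * s / (d * s) + d * s) / 2 <= 6 * d * s + C * (s * y + 1).
Proof.
move=> d0 d1 s1 y0 -> ->; have s0 : 0 < s by lra.
have dn := lt0r_neq0 d0; have sn := lt0r_neq0 s0.
have iv : 0 <= d^-1 by rewrite invr_ge0 ltW.
have iv7 : 0 <= d^-1 ^+ 7 by rewrite exprn_ge0.
have is1 : s^-1 <= 1 by rewrite invf_le1.
have sy : 0 <= s * y by rewrite mulr_ge0 // ltW.
have -> : 2 / d * (2 + d ^+ 2 / s * (2 * (s ^+ 2 * y) + s + s ^+ 2) +
             32 / (d ^+ 2 * d ^+ 4 * s) * (12 * (s ^+ 2 * y) + 10 * s + 2)) =
   4 * d^-1 + 4 * (d * (s * y)) + 2 * d + 2 * d * s +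
   64 * d^-1 ^+ 7 * (12 * (s * y) + 10 + 2 * s^-1).
  by field; rewrite dn sn.
have -> : 2 * s / (d * s) = 2 * d^-1 by field; rewrite dn sn.
have -> : 768 / d ^+ 7 = 768 * d^-1 ^+ 7 by rewrite exprVn.
have h1 := ler_wpM2r sy d1.
have h2 : 64 * d^-1 ^+ 7 * (12 * (s * y) + 10 + 2 * s^-1) <=
    768 * d^-1 ^+ 7 * (s * y + 1).
  have -> : 768 * d^-1 ^+ 7 * (s * y + 1) = 64 * d^-1 ^+ 7 * (12 * (s * y) + 12) by ring.
  apply: ler_wpM2l; [exact: mulr_ge0 | lra].
have h3 := mulr_ge0 iv sy.
have h5 : 0 <= d * s by rewrite mulr_ge0 // ltW; lra.
move: h1 h2 h3 h5 sy iv iv7; move: (d^-1 ^+ 7) (s * y) (d^-1) (s^-1) => a b c g.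
clear -d1 d0; lra.
Qed.

Lemma word_mean_asym (eps : R) : 0 < eps ->
  exists N0 : nat, forall n T, (N0 <= n)%N -> (N0 <= T)%N ->
    `|word_mean R n.+1 T - (T%:R / n.+1%:R + 2 * Num.sqrt T%:R)|
    <= eps * Num.sqrt T%:R.
Proof.
(* With [d <= eps / 12] the term [6 * d * s] of [lower_error] uses half of [eps]; the other half
   covers [C * (s * y + 1)] for large [n] and [T]. *)
move=> e0; pose d : R := Num.min (1 / 2) (eps / 12).
have d0 : 0 < d by rewrite lt_min; apply/andP; split; lra.
have d1 : d <= 1 / 2 by rewrite ge_min lexx.
have d2 : d <= eps / 12 by rewrite ge_min lexx orbT.
pose C := 10 + 5 / d + 768 / d ^+ 7.
have C0 : 0 <= C.
  by rewrite /C !addr_ge0 // ?divr_ge0 // ?exprn_ge0 // ltW.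
have [A hA] := sqrt_above 1.
have [B hB] := sqrt_above (2 * (1 + eps^-1) / eps).
have [D hD] := sqrt_above (4 / d).
have [E hE] := sqrt_above (4 * C / eps).
have [F hF] := nat_above (4 * C / eps).
exists (A + B + D + E + F + 1)%N => n T hn hT.
set s : R := Num.sqrt T%:R.
have s1 : 1 <= s by apply: hA; clear -hT; lia.
have s2 : 2 * (1 + eps^-1) / eps <= s by apply: hB; clear -hT; lia.
have s3 : 4 / d <= s by apply: hD; clear -hT; lia.
have s4 : 4 * C / eps <= s by apply: hE; clear -hT; lia.
have n4 : 4 * C / eps <= n.+1%:R by apply: hF; clear -hn; lia.
have T0 : (0 < T)%N by clear -hT; lia.
have s0 : 0 < s by lra.
rewrite ler_norml; apply/andP; split; last first.
  have := @word_mean_upper R n T eps T0 e0; cbv zeta; rewrite -/s.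
  have := upper_error e0 s1 s2; move: (word_mean _ _ _) (T%:R / _) (_ / (eps * s)) => v1 v2 v3.
  clear; lra.
have ds : 4 <= d * s by rewrite mulrC -ler_pdivrMr.
have := @word_mean_lower R n T d (d ^+ 2) T0 d0 d1 (exprn_gt0 _ d0) ds.
cbv zeta; rewrite -/s; set y : R := n.+1%:R^-1.
have y0 : 0 <= y by rewrite invr_ge0.
have kE : T%:R * y = s ^+ 2 * y by rewrite sqr_sqrtr.
have := lower_error d0 d1 s1 y0 kE (erefl C).
have : C * (s * y + 1) <= eps / 2 * s.
  have h1 : C <= eps / 4 * s by move: s4; rewrite ler_pdivrMr //; lra.
  have h2 : C * y <= eps / 4.
    rewrite ler_pdivrMr ?ltr0n //; move: n4; rewrite ler_pdivrMr //; lra.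
  have := ler_wpM2r (ltW s0) h2; lra.
have := ler_wpM2r (ltW s0) d2.
move: (C * _) (2 / d * _) (2 * s / _) (word_mean _ _ _) => c1 c2 c3 c4.
move: (s * y) (T%:R * y) => c5 c6.
clear; lra.
Qed.

End Asymptotics.

(** * Random rearrangements of a multiset *)

Lemma perm_eq_rem (X : eqType) (x : X) (w w' : seq X) : perm_eq w w' ->
  perm_eq (rem x w) (rem x w').
Proof.
move=> ww; have [xw|xw] := boolP (x \in w); last first.
  by rewrite !rem_id // -(perm_mem ww).
rewrite -(perm_cons x); apply: (@perm_trans _ w).
  by rewrite perm_sym perm_to_rem.
by apply: (perm_trans ww); rewrite perm_to_rem // -(perm_mem ww).
Qed.

Section Rearrangement.
Variable R : realType.
Implicit Types (F G : seq nat -> R) (w v : seq nat).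

(* Average of [F] over the random orderings of the multiset [w]: a uniformly
   chosen letter comes first. *)
Fixpoint shuffle_rec m w F : R :=
  if m is m'.+1 then
    m'.+1%:R^-1 * \sum_(x <- w) shuffle_rec m' (rem x w) (fun v => F (x :: v))
  else F [::].

Definition shuffle w F : R := shuffle_rec (size w) w F.

Lemma shuffle_rec_perm m w w' F : perm_eq w w' ->
  shuffle_rec m w F = shuffle_rec m w' F.
Proof.
elim: m w w' F => // m IH w w' F ww /=; congr (_ * _).
rewrite (perm_big _ ww) /=; apply: eq_bigr => x _; apply: IH.
exact: perm_eq_rem.
Qed.

Lemma shuffle_perm w w' F : perm_eq w w' -> shuffle w F = shuffle w' F.
Proof. by move=> h; rewrite /shuffle (perm_size h); apply: shuffle_rec_perm. Qed.

Lemma size_rem1 w x m : size w = m.+1 -> x \in w -> size (rem x w) = m.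
Proof. by move=> sw xw; rewrite size_rem // sw. Qed.

Lemma shuffle_rec_le m w F G : size w = m ->
  (forall v, perm_eq v w -> F v <= G v) ->
  shuffle_rec m w F <= shuffle_rec m w G.
Proof.
elim: m w F G => [|m IH] w F G sw h /=.
  by apply: h; rewrite (size0nil sw).
apply: ler_wpM2l; first by rewrite invr_ge0.
rewrite big_seq [leRHS]big_seq; apply: ler_sum => x xw.
apply: IH; first exact: size_rem1.
move=> v vw; apply: h; rewrite perm_sym; apply: perm_trans (perm_to_rem xw) _.
by rewrite perm_cons perm_sym.
Qed.

Lemma shuffle_le w F G : (forall v, perm_eq v w -> F v <= G v) ->
  shuffle w F <= shuffle w G.
Proof. exact: shuffle_rec_le. Qed.

Lemma shuffle_rec_eq m w F G : size w = m ->
  (forall v, perm_eq v w -> F v = G v) -> shuffle_rec m w F = shuffle_rec m w G.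
Proof.
by move=> sw h; apply/eqP; rewrite eq_le; apply/andP; split;
  apply: shuffle_rec_le => // v /h ->.
Qed.

Lemma shuffle_recN m w F : shuffle_rec m w (fun v => - F v) = - shuffle_rec m w F.
Proof.
elim: m w F => // m IH w F /=; rewrite -mulrN -sumrN; congr (_ * _).
by apply: eq_bigr => x _; rewrite -IH.
Qed.

Lemma shuffle_recD m w F G :
  shuffle_rec m w (fun v => F v + G v) = shuffle_rec m w F + shuffle_rec m w G.
Proof.
elim: m w F G => // m IH w F G /=; rewrite -mulrDr -big_split; congr (_ * _).
by apply: eq_bigr => x _; rewrite /= -IH.
Qed.

Lemma shuffle_rec_cst m w c : size w = m -> shuffle_rec m w (fun _ => c) = c.
Proof.
elim: m w => // m IH w sw /=; rewrite big_seq (eq_bigr (fun _ => c)); last first.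
  by move=> x xw; apply: IH; apply: size_rem1.
rewrite -big_seq big_const_seq count_predT sw iter_addr addr0 -[c *+ _]mulr_natl.
by rewrite mulKf // pnatr_eq0.
Qed.

(** Deleting [y] from a random ordering of [y :: w] leaves a random ordering of [w], so a comparison
    under deletion passes to the averages. *)
Lemma shuffle_rec_insert m w y F G : size w = m ->
  (forall v1 v2, G (v1 ++ v2) <= F (v1 ++ y :: v2)) ->
  shuffle_rec m w G <= shuffle_rec m.+1 (y :: w) F.
Proof.
elim: m w F G => [|m IH] w F G sw h.
  by rewrite (size0nil sw) /= big_seq1 invr1 mul1r; apply: (h [::] [::]).
rewrite -[leRHS]/(m.+2%:R^-1 * \sum_(x <- y :: w)
   shuffle_rec m.+1 (rem x (y :: w)) (fun v => F (x :: v))).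
rewrite mulrC ler_pdivlMr ?ltr0n // mulrC -natr1 mulrDl mul1r addrC big_cons.
apply: lerD.
  have -> : rem y (y :: w) = w by rewrite /= eqxx.
  by apply: shuffle_rec_le => // v _; apply: (h [::]).
rewrite -[shuffle_rec m.+1 w G]/(m.+1%:R^-1 * \sum_(x <- w)
   shuffle_rec m (rem x w) (fun v => G (x :: v))).
rewrite mulVKf ?pnatr_eq0 // big_seq [leRHS]big_seq; apply: ler_sum => x xw.
have pe : perm_eq (rem x (y :: w)) (y :: rem x w).
  have h1 : x \in y :: w by rewrite inE xw orbT.
  rewrite -(perm_cons x); apply: (@perm_trans _ (y :: w)).
    by rewrite perm_sym; apply: perm_to_rem.
  apply: (@perm_trans _ (y :: x :: rem x w)).
    by rewrite perm_cons; apply: perm_to_rem.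
  by apply/permP => p /=; rewrite addnCA.
rewrite (shuffle_rec_perm _ _ pe); apply: IH; first exact: size_rem1.
by move=> v1 v2; apply: (h (x :: v1)).
Qed.

Definition shuffle_lnd w : R := shuffle w (fun v => (lnd 0 v)%:R).

Lemma shuffle_lnd_cons y w : shuffle_lnd w <= shuffle_lnd (y :: w) <= shuffle_lnd w + 1.
Proof.
apply/andP; split.
  apply: shuffle_rec_insert => // v1 v2.
  by rewrite ler_nat; case/andP: (lnd_insert 0 v1 y v2).
(* The upper half is the same comparison for the negated functions. *)
rewrite -[1](shuffle_rec_cst 1 (erefl (size w))) -shuffle_recD -lerN2 -!shuffle_recN.
apply: shuffle_rec_insert => // v1 v2.
by rewrite lerN2 natr1 ler_nat; case/andP: (lnd_insert 0 v1 y v2).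
Qed.

Lemma shuffle_lnd_cat u w : shuffle_lnd w <= shuffle_lnd (u ++ w).
Proof.
elim: u => //= y u IH; apply: le_trans IH _.
by case/andP: (shuffle_lnd_cons y (u ++ w)).
Qed.

Lemma shuffle_lnd_size w : shuffle_lnd w <= (size w)%:R.
Proof.
rewrite -[leRHS](shuffle_rec_cst _ (erefl (size w))); apply: shuffle_le => v vw.
by rewrite ler_nat -(perm_size vw) lnd_size.
Qed.

Lemma shuffle_lnd_ge0 w : 0 <= shuffle_lnd w.
Proof.
by rewrite -[leLHS](shuffle_rec_cst 0 (erefl (size w))); apply: shuffle_le.
Qed.

Lemma shuffle_rec_map (f : nat -> nat) m w F : size w = m ->
  shuffle_rec m (map f w) F = shuffle_rec m w (fun v => F (map f v)).
Proof.
elim: m w F => // m IH w F sw /=; congr (_ * _); rewrite big_map.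
rewrite big_seq [RHS]big_seq; apply: eq_bigr => x xw.
apply: etrans (IH _ (fun v => F (f x :: v)) (size_rem1 sw xw)).
apply: shuffle_rec_perm; rewrite -(perm_cons (f x)).
apply: (@perm_trans _ (map f w)); last exact: (perm_map f (perm_to_rem xw)).
by rewrite perm_sym perm_to_rem ?map_f.
Qed.

Lemma shuffle_lnd_map (f : nat -> nat) w : (forall x y, (x <= y)%N -> (f x <= f y)%N) ->
  shuffle_lnd w <= shuffle_lnd (map f w).
Proof.
move=> fm; rewrite /shuffle_lnd /shuffle size_map shuffle_rec_map //.
by apply: shuffle_rec_le => // v _; rewrite ler_nat; apply: lnd_map.
Qed.

(* Removing the excess letters of [a] costs one each; what is left embeds in [b]. *)
Lemma shuffle_lnd_compare n a b : all (fun x => x < n)%N a ->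
  shuffle_lnd a <= shuffle_lnd b +
    \sum_(i <- iota 0 n) (count_mem i a - count_mem i b)%:R.
Proof.
have [m] := ubnP (size a); elim: m a => // m IH a /ltnSE am an.
have [/hasP [i ia hi]|/hasPn hN] := boolP (has (fun i => count_mem i b < count_mem i a)%N a).
  have pa := perm_to_rem ia.
  have sz : size (rem i a) = (size a).-1 by apply: size_rem.
  have a0 : (0 < size a)%N by case: (a) ia.
  have hrem : all (fun x => x < n)%N (rem i a).
    by move: an; rewrite (perm_all _ pa) => /andP[].
  have /(_ _)/(_ hrem) := IH (rem i a); rewrite sz => /(_ _)/le_trans h.
  rewrite /shuffle_lnd (shuffle_perm _ pa) -/(shuffle_lnd _) -/(shuffle_lnd b).
  have /andP[_ h2] := shuffle_lnd_cons i (rem i a).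
  apply: le_trans h2 _.
  have hin : (i < n)%N by apply: (allP an).
  have -> : \sum_(j <- iota 0 n) (count_mem j a - count_mem j b)%:R =
     \sum_(j <- iota 0 n) (count_mem j (rem i a) - count_mem j b)%:R + 1 :> R.
    rewrite (bigD1_seq i) ?mem_iota ?iota_uniq //= [in RHS](bigD1_seq i) ?mem_iota ?iota_uniq //=.
    rewrite addrAC; congr (_ + _); last first.
      apply: eq_bigr => j ji; rewrite (permP pa (pred1 j)) /=.
      by rewrite eq_sym (negbTE ji).
    rewrite natr1; congr (_%:R); move: hi; rewrite (permP pa (pred1 i)) /= eqxx.
    by clear; lia.
  rewrite addrA lerD2r; apply: h => //.
  by move: am a0; clear; lia.
have [c sc ac] : exists2 c, subseq c b & perm_eq a c.
  apply/count_subseqP => i; have [ia|ia] := boolP (i \in a).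
    by rewrite leqNgt; apply: hN.
  by rewrite (count_memPn ia).
have [r br] := perm_to_subseq sc.
apply: (@le_trans _ _ (shuffle_lnd b)); last by rewrite lerDl sumr_ge0.
rewrite /shuffle_lnd (shuffle_perm _ ac) (shuffle_perm _ br).
rewrite [leRHS](shuffle_perm (w' := r ++ c)); last by rewrite perm_catC.
exact: shuffle_lnd_cat.
Qed.

Lemma EW_delete (mu : seq (R * nat)) T i (H : nat -> seq nat -> R) : (i <= T)%N ->
  EW mu T.+1 (fun w => H (nth 0%N w i) (take i w ++ drop i.+1 w)) =
  E1 mu (fun x => EW mu T (H x)).
Proof.
elim: i T H => [|i IH] T H iT.
  by rewrite /=; apply: E1_eq => x; apply: EW_eq => w; rewrite drop0.
case: T iT => // T iT.
rewrite -[LHS]/(E1 mu (fun y => EW mu T.+1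
  (fun w => H (nth 0%N w i) (y :: take i w ++ drop i.+1 w)))).
under E1_eq => y do rewrite (IH T (fun x v => H x (y :: v)) iT).
rewrite /= /E1; under eq_bigr => a _ do rewrite mulr_sumr.
rewrite exchange_big /=; apply: eq_bigr => a _.
by rewrite mulr_sumr; apply: eq_bigr => c _; rewrite mulrCA.
Qed.

Lemma perm_delete w i : (i < size w)%N ->
  perm_eq w (nth 0%N w i :: take i w ++ drop i.+1 w).
Proof.
move=> iw; rewrite -{1}(cat_take_drop i w) (drop_nth 0%N iw).
by apply/permP => p; rewrite !count_cat /= count_cat addnCA.
Qed.

(** A word of independent letters is exchangeable: by [EW_delete] the letter at any position may be
    drawn first, and averaging over the position gives one step of the shuffle. *)
Lemma EW_shuffle (mu : seq (R * nat)) T F :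
  EW mu T F = EW mu T (fun w => shuffle_rec T w F).
Proof.
elim: T F => // T IH F.
have -> : EW mu T.+1 (fun w => shuffle_rec T.+1 w F) =
   EW mu T.+1 (fun w => T.+1%:R^-1 * \sum_(i <- iota 0 T.+1)
     shuffle_rec T (take i w ++ drop i.+1 w) (fun v => F (nth 0%N w i :: v))).
  apply: (EW_ext (P := xpredT)) => [|w sw _]; first by elim: (mu).
  rewrite -[LHS]/(T.+1%:R^-1 * \sum_(x <- w)
    shuffle_rec T (rem x w) (fun v => F (x :: v))); congr (_ * _).
  rewrite (big_nth 0%N) sw /index_iota subn0 !big_seq; apply: eq_bigr => i.
  rewrite mem_iota add0n => /andP[_ iT].
  apply: shuffle_rec_perm; rewrite -(perm_cons (nth 0%N w i)).
  apply: perm_trans (perm_delete _); last by rewrite sw.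
  by rewrite perm_sym; apply: perm_to_rem; rewrite mem_nth // sw.
rewrite EWZ EW_sum big_seq (eq_bigr (fun _ => EW mu T.+1 F)).
  rewrite -big_seq big_const_seq count_predT size_iota iter_addr addr0 -[X in _ * X]mulr_natl.
  by rewrite mulKf // pnatr_eq0.
move=> i; rewrite mem_iota add0n => /andP[_ iT].
rewrite (EW_delete mu (fun x v => shuffle_rec T v (fun u => F (x :: u)))) //.
by apply: E1_eq => x; rewrite -(IH (fun u => F (x :: u))).
Qed.

End Rearrangement.

(** * Multiset permutations as shuffles of the sorted word *)

Definition std_word (k n : nat) : seq nat := [seq (x %/ k)%N | x <- iota 0 (k * n)].

Lemma std_wordS k n : (0 < k)%N -> std_word k n.+1 = std_word k n ++ nseq k n.
Proof.
move=> k0; rewrite /std_word mulnS addnC iotaD map_cat add0n; congr (_ ++ _).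
apply: (@eq_from_nth _ 0%N); rewrite ?size_map ?size_iota ?size_nseq // => i ik.
rewrite (nth_map 0%N) ?size_iota // nth_iota // nth_nseq ik.
by rewrite mulnC divnMDl // divn_small // addn0.
Qed.

Lemma count_std_word k n i : (0 < k)%N ->
  count_mem i (std_word k n) = (if (i < n)%N then k else 0)%N.
Proof.
move=> k0; elim: n => [|n IH]; first by rewrite /std_word muln0.
rewrite std_wordS // count_cat IH count_nseq /= ltnS [(i <= n)%N]leq_eqVlt eq_sym.
by case: eqP => [->|_]; rewrite ?ltnn ?mul1n //= mul0n addn0.
Qed.

Lemma size_std_word k n : size (std_word k n) = (k * n)%N.
Proof. by rewrite size_map size_iota. Qed.

Lemma std_word_supp k n : (0 < k)%N -> all (fun x => x < n)%N (std_word k n).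
Proof.
move=> k0; rewrite all_map; apply/allP => x /=; rewrite mem_iota add0n => /andP[_ h].
by rewrite ltn_divLR // mulnC.
Qed.

Lemma perm_std_word k n (w : (k * n).-tuple 'I_n) : (0 < k)%N ->
  perm_eq (map val w) (std_word k n) = (w \in multiset_perms k n).
Proof.
move=> k0; rewrite inE.
have cnt (i : 'I_n) : count_mem (val i) (map val w) = count_mem i w.
  by rewrite count_map; apply: eq_count => x /=; rewrite (inj_eq val_inj).
apply/idP/forallP => [/permP h i|h].
  by rewrite -cnt h count_std_word // ltn_ord.
apply/allP => i _ /=; rewrite count_std_word //; case: ifP => [hi|hi].
  by rewrite (cnt (Ordinal hi)) h.
apply/eqP/count_memPn/negP => /mapP [x _ e].
by rewrite e ltn_ord in hi.
Qed.

Section Counting.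
Variable R : realType.

Lemma sum_tuples n N (F : seq nat -> R) :
  \sum_(w : N.-tuple 'I_n.+1) F (map val w) = n.+1%:R ^+ N * EW (unif R n.+1) N F.
Proof.
elim: N F => [|N IH] F.
  rewrite expr0 mul1r /= (big_pred1 [tuple]) // => t.
  by apply/esym/eqP; apply: tuple0.
pose cons2 (p : 'I_n.+1 * N.-tuple 'I_n.+1) := cons_tuple p.1 p.2.
rewrite (reindex cons2) /=; last first.
  exists (fun t : N.+1.-tuple 'I_n.+1 => (thead t, [tuple of behead t])).
    by move=> [x t] _; congr pair; apply/val_inj.
  by move=> t _; rewrite [RHS]tuple_eta; apply/val_inj.
rewrite -(pair_bigA _ (fun i (t : N.-tuple 'I_n.+1) => F (map val (cons2 (i, t))))) /=.
rewrite E1_unif exprSr -mulrA mulVKf ?pnatr_eq0 // mulr_sumr.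
have -> : iota 0 n.+1 = index_iota 0 n.+1 by rewrite /index_iota subn0.
rewrite big_mkord; apply: eq_bigr => i _.
exact: (IH (fun w => F (val i :: w))).
Qed.

(** Shuffling a uniform word preserves its multiset, so every rearrangement of [std_word]
    contributes the same average, and the indicator [P] kills all other words. *)
Lemma expected_LNDS_shuffle k n : (0 < k)%N ->
  expected_LNDS R k n.+1 = shuffle_lnd R (std_word k n.+1).
Proof.
move=> k0; set N := (k * n.+1)%N; set w0 := std_word k n.+1.
pose P (v : seq nat) : R := (perm_eq v w0)%:R.
have sw0 : size w0 = N by apply: size_std_word.
have num : \sum_(w in multiset_perms k n.+1) (LNDS w)%:R =
    #|multiset_perms k n.+1|%:R * shuffle_lnd R w0.
  have -> : \sum_(w in multiset_perms k n.+1) (LNDS w)%:R =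
     \sum_(w : N.-tuple 'I_n.+1) P (map val w) * (lnd 0 (map val w))%:R.
    rewrite big_mkcond; apply: eq_bigr => w _.
    by rewrite /P perm_std_word // -LNDS_lnd; case: ifP; rewrite ?mul1r ?mul0r.
  have -> : #|multiset_perms k n.+1|%:R =
     \sum_(w : N.-tuple 'I_n.+1) P (map val w).
    rewrite -sum1_card natr_sum big_mkcond; apply: eq_bigr => w _.
    by rewrite /P perm_std_word //; case: ifP.
  rewrite (sum_tuples _ _ (fun v => P v * (lnd 0 v)%:R)) (sum_tuples _ _ P) -mulrA.
  congr (_ * _); rewrite EW_shuffle mulrC -EWZ.
  apply: (EW_ext (P := xpredT)) => [|w sw _]; first exact: E1_all.
  rewrite /P; case: (boolP (perm_eq w w0)) => pw.
    rewrite mulr1 /shuffle_lnd -(shuffle_perm _ pw) /shuffle sw.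
    apply: shuffle_rec_eq => // v vw.
    by rewrite (perm_trans vw pw) mul1r.
  rewrite mulr0 -[RHS](@shuffle_rec_cst R N w 0) //.
  apply: shuffle_rec_eq => // v vw; rewrite (_ : perm_eq v w0 = false) ?mul0r //.
  by apply: contraNF pw => h; apply: perm_trans h; rewrite perm_sym.
rewrite /expected_LNDS num mulrC mulKf // pnatr_eq0 -lt0n.
apply/card_gt0P.
have sz : size (map inord w0 : seq 'I_n.+1) == N by rewrite size_map sw0.
(* The sorted word witnesses that the denominator is nonzero. *)
exists (Tuple sz); rewrite -perm_std_word //= -map_comp.
rewrite (eq_in_map _ id _).1 ?map_id //.
move=> x xw /=; rewrite inordK //; exact: (allP (std_word_supp n.+1 k0)).
Qed.

Definition mean_lnds k n : R := shuffle_lnd R (std_word k n).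

Lemma mean_lnds_ge0 k n : 0 <= mean_lnds k n.
Proof. exact: shuffle_lnd_ge0. Qed.

(** Since [std_word] is built by integer division, merging [j] consecutive letters is a further
    division, which is monotone. *)
Lemma mean_lnds_merge k j n : mean_lnds k (j * n) <= mean_lnds (j * k) n.
Proof.
rewrite /mean_lnds (_ : std_word (j * k) n = map (fun x => x %/ j)%N (std_word k (j * n))).
  by apply: shuffle_lnd_map => x y; apply: leq_div2r.
rewrite /std_word -map_comp mulnCA mulnA; apply: eq_map => x /=.
by rewrite -divnMA mulnC.
Qed.

Lemma mean_lnds_mono k n n' : (0 < k)%N -> (n <= n')%N ->
  mean_lnds k n <= mean_lnds k n'.
Proof.
move=> k0 /subnKC <-; elim: (n' - n)%N => [|d IH]; first by rewrite addn0.
apply: le_trans IH _; rewrite addnS /mean_lnds std_wordS //.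
have h : perm_eq (std_word k (n + d) ++ nseq k (n + d))
                 (nseq k (n + d) ++ std_word k (n + d)) by rewrite perm_catC.
rewrite [leRHS](shuffle_perm _ h); exact: shuffle_lnd_cat.
Qed.

Lemma unif_supp n : all (fun a => a.2 < n)%N (unif R n).
Proof. by rewrite all_map; apply/allP => i; rewrite mem_iota. Qed.

Lemma word_mean_shuffle n T : word_mean R n T = EW (unif R n) T (shuffle_lnd R).
Proof.
rewrite /word_mean EW_shuffle.
by apply: (EW_ext (P := xpredT)) => [|w <- _]; first exact: E1_all.
Qed.

(** Truncated subtraction keeps only the deficits: letters that occur too often in the random word
    cost nothing in this direction. *)
Lemma mean_lnds_le k n T : (0 < k)%N -> mean_lnds k n.+1 <= word_mean R n.+1 T +
  \sum_(i <- iota 0 n.+1) EW (unif R n.+1) T (fun w => (k - count_mem i w)%:R).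
Proof.
move=> k0; have lu := unif_law R n.
rewrite word_mean_shuffle -EW_sum -EWD -(EW_cst lu T (mean_lnds _ _)).
apply: (EW_le lu) => w.
apply: le_trans (shuffle_lnd_compare R w (std_word_supp n.+1 k0)) _.
rewrite lerD2l big_seq [leRHS]big_seq; apply: ler_sum => i.
by rewrite mem_iota add0n count_std_word // => /andP[_ ->].
Qed.

Lemma mean_lnds_ge k n T : (0 < k)%N -> word_mean R n.+1 T <= mean_lnds k n.+1 +
  \sum_(i <- iota 0 n.+1) EW (unif R n.+1) T (fun w => (count_mem i w - k)%:R).
Proof.
move=> k0; have lu := unif_law R n.
rewrite word_mean_shuffle -EW_sum -(EW_cst lu T (mean_lnds _ _)) -EWD.
apply: (EW_le_in (P := fun x => (x < n.+1)%N) lu (unif_supp n.+1)) => w sw hw.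
apply: le_trans (shuffle_lnd_compare R (std_word k n.+1) hw) _.
rewrite lerD2l big_seq [leRHS]big_seq; apply: ler_sum => i.
by rewrite mem_iota add0n count_std_word // => /andP[_ ->].
Qed.

(* Ranking the letters turns a word without repetition into a permutation. *)
Lemma shuffle_lnd_uniq w : uniq w -> shuffle_lnd R w <= mean_lnds 1 (size w).
Proof.
move=> uw; pose rk y := count (fun z => z < y)%N w.
have rk_mono x y : (x <= y)%N -> (rk x <= rk y)%N.
  by move=> xy; apply: sub_count => z /= /leq_trans; apply.
have rk_lt x y : x \in w -> (x < y)%N -> (rk x < rk y)%N.
  move=> xw xy; rewrite /rk.
  have -> : count (fun z => z < y)%N w =
      (count (fun z => z < x)%N w + count (fun z => x <= z < y)%N w)%N.
    elim: (w) => //= z r ->; rewrite addnACA; congr (_ + _)%N.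
    by have := xy; clear; case: ltngtP => //; case: ltngtP => //; lia.
  rewrite -[ltnLHS]addn0 ltn_add2l -has_count; apply/hasP; exists x => //.
  by rewrite leqnn xy.
apply: le_trans (shuffle_lnd_map R w rk_mono) _.
rewrite le_eqVlt; apply/orP; left; apply/eqP; apply: shuffle_perm.
have -> : std_word 1 (size w) = iota 0 (size w).
  by rewrite /std_word mul1n; under eq_map => x do rewrite divn1; rewrite map_id.
have urk : uniq (map rk w).
  rewrite map_inj_in_uniq // => x y xw yw e.
  by case: (ltngtP x y) => // /rk_lt; [move=> /(_ xw) | move=> /(_ yw)]; rewrite e ltnn.
have srk : {subset map rk w <= iota 0 (size w)}.
  move=> z /mapP [x xw ->]; rewrite mem_iota add0n /=.
  rewrite -[ltnRHS](count_predC (fun z => z < x)%N) -[ltnLHS]addn0 ltn_add2l.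
  by rewrite -has_count; apply/hasP; exists x => //=; rewrite ltnn.
apply: uniq_perm; rewrite ?iota_uniq //.
have sz : (size (iota 0 (size w)) <= size (map rk w))%N by rewrite size_map size_iota.
by have [_ e] := uniq_min_size urk srk sz.
Qed.

(** Birthday bound: a new letter equals a given earlier one with probability at most [1 / n.+1]. *)
Lemma EW_not_uniq n T :
  EW (unif R n.+1) T (fun w => (~~ uniq w)%:R) <= T%:R ^+ 2 / n.+1%:R.
Proof.
have lu := unif_law R n; set m : R := n.+1%:R.
have m0 : 0 < m by rewrite ltr0n.
have one y : E1 (unif R n.+1) (fun x => (x == y)%:R) <= m^-1.
  rewrite E1_unif -[leRHS]mulr1; apply: ler_wpM2l; first by rewrite invr_ge0 ltW.
  by rewrite -natr_count count_uniq_mem ?iota_uniq // lern1 leq_b1.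
have mem w : E1 (unif R n.+1) (fun x => (x \in w)%:R) <= (size w)%:R * m^-1.
  elim: w => [|y w IH].
    rewrite (@E1_eq _ _ _ _ (fun=> 0)) ?mul0r ?E1_cst //.
  rewrite /= -natr1 mulrDl mul1r addrC; apply: le_trans (lerD (one y) IH).
  rewrite -E1D; apply: (E1_le lu (P := xpredT)) => [|x _]; first exact: E1_all.
  by rewrite inE -natrD ler_nat; case: (x == y); case: (x \in w).
elim: T => [|T IH]; first by rewrite /= expr0n mul0r.
apply: (@le_trans _ _ (EW (unif R n.+1) T (fun w => E1 (unif R n.+1) (fun x => (x \in w)%:R))
    + EW (unif R n.+1) T (fun w => (~~ uniq w)%:R))).
  rewrite EW_E1 -[X in _ <= _ + X](E1_cst lu) -E1D.
  apply: (E1_le lu (P := xpredT)) => [|x _]; first exact: E1_all.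
  rewrite -EWD; apply: (EW_le lu) => w /=.
  by rewrite negb_and negbK -natrD ler_nat; case: (x \in w); case: (uniq w).
have h : EW (unif R n.+1) T (fun w => E1 (unif R n.+1) (fun x => (x \in w)%:R)) <= T%:R * m^-1.
  rewrite -[leRHS](EW_cst lu T); apply: (EW_le_in (P := xpredT) lu) => [|w sw _].
    exact: E1_all.
  by rewrite -sw.
apply: le_trans (lerD h IH) _; rewrite -mulrDl.
apply: ler_wpM2r; first by rewrite invr_ge0 ltW.
by rewrite -natr1; have : 0 <= T%:R :> R by []; clear; nra.
Qed.

(** Words with a repetition are charged the trivial bound [T], whence the cube. *)
Lemma word_mean_le_perm n T :
  word_mean R n.+1 T <= mean_lnds 1 T + T%:R ^+ 3 / n.+1%:R.
Proof.
have lu := unif_law R n.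
rewrite word_mean_shuffle exprS -mulrA.
apply: (@le_trans _ _ (mean_lnds 1 T +
    T%:R * EW (unif R n.+1) T (fun w => (~~ uniq w)%:R))).
  rewrite -[mean_lnds 1 T](EW_cst lu T) -EWZ -EWD.
  apply: (EW_le_in (P := xpredT) lu) => [|w sw _]; first exact: E1_all.
  case: (boolP (uniq w)) => [uw|_].
    by rewrite mulr0 addr0 -sw; apply: shuffle_lnd_uniq.
  rewrite mulr1 -sw; apply: le_trans (shuffle_lnd_size R w) _.
  by rewrite lerDr mean_lnds_ge0.
by rewrite lerD2l; apply: ler_wpM2l => //; apply: EW_not_uniq.
Qed.

(** The alphabet size [n.+1] is free: taken huge, it makes random words into permutations, whose
    consecutive letters are then merged [k] at a time. *)
Lemma mean_lnds_ge_words k N n : (0 < k)%N ->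
  word_mean R n.+1 (k * N) - (k * N)%:R ^+ 3 / n.+1%:R <= mean_lnds k N.
Proof.
move=> k0; rewrite lerBlDr; apply: le_trans (word_mean_le_perm n (k * N)) _.
by rewrite lerD2r; have := mean_lnds_merge 1 k N; rewrite muln1.
Qed.

End Counting.

(** * Comparison of multiset permutations and random words *)

Section Chernoff.
Variable R : realType.

Lemma bernoulli (x : R) m : 0 <= x -> 1 + m%:R * x <= (1 + x) ^+ m.
Proof.
move=> x0; elim: m => [|m IH]; first by rewrite mul0r addr0.
have m0 : 0 <= m%:R :> R by [].
have h : 0 <= 1 + x by lra.
have := ler_wpM2l h IH; rewrite exprS -natr1; have := mulr_ge0 m0 (sqr_ge0 x).
by clear; nra.
Qed.

Lemma EW_count_moment (z : R) n i m : 0 < z -> (i < n.+1)%N ->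
  EW (unif R n.+1) (n.+1 * m) (fun w => z ^+ count_mem i w) <=
  expR (m%:R * (z - 1)).
Proof.
move=> z0 hi; have n0 : n.+1%:R != 0 :> R by rewrite pnatr_eq0.
have -> : EW (unif R n.+1) (n.+1 * m) (fun w => z ^+ count_mem i w) =
    (1 + (z - 1) / n.+1%:R) ^+ (n.+1 * m).
  have -> : 1 + (z - 1) / n.+1%:R = E1 (unif R n.+1) (fun x => if x == i then z else 1).
    rewrite E1_unif (eq_bigr (fun x => 1 + (z - 1) * (x == i)%:R)); last first.
      by move=> x _; case: (x == i); rewrite ?mulr1 ?mulr0; ring.
    set r := iota 0 n.+1; rewrite big_split /= -mulr_sumr -natr_count /r.
    rewrite count_uniq_mem ?iota_uniq // mem_iota add0n hi big_const_seq count_predT size_iota iter_addr addr0.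
    by rewrite -[1 *+ n.+1]/(n.+1%:R) mulr1 mulrDr mulVf // mulrC.
  rewrite -EW_prod; apply: EW_eq => w; elim: w => [|x w IH]; first by rewrite big_nil.
  by rewrite big_cons /= exprD IH; case: (x == i); rewrite ?expr1 ?expr0.
have -> : m%:R * (z - 1) = (n.+1 * m)%:R * ((z - 1) / n.+1%:R).
  by rewrite natrM [n.+1%:R * _]mulrC -mulrA [n.+1%:R * (_ / _)]mulrCA mulfV // mulr1.
rewrite expRM_natl; apply: lerXn2r; rewrite ?nnegrE ?expR_ge0 ?expR_ge1Dx //.
have h : n.+1%:R^-1 <= 1 :> R by rewrite invf_le1 ?ltr0n // ler1n.
have h0 : 0 <= n.+1%:R^-1 :> R by rewrite invr_ge0.
by move: h h0; move: (n.+1%:R^-1) => j h h0; have := mulr_ge0 (ltW z0) h0; lra.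
Qed.

Lemma expRN_le (x : R) : 0 < x -> expR (- x) <= x^-1.
Proof.
move=> x0; rewrite expRN lef_pV2 ?posrE ?expR_gt0 //.
by apply: le_trans (expR_ge1Dx x); rewrite lerDr.
Qed.

Section Tail.
Variables (n k a i : nat).
Hypotheses (a0 : (0 < a)%N) (hi : (i < n.+1)%N).
(** The tilting parameter, which minimises the quadratic [k * s ^+ 2 - a * s]. The exponential is
    used only through [expR (- x) <= x^-1]: polynomial decay is enough. *)
Let s : R := a%:R / (2 * k%:R).

Let tail (y : R) : (0 < k)%N -> y <= - (s * a%:R / 4) ->
  s^-1 * expR y <= 16 * k%:R ^+ 2 / a%:R ^+ 3.
Proof.
move=> k0 hy; have aR : 0 < a%:R :> R by rewrite ltr0n.
have kR : 0 < k%:R :> R by rewrite ltr0n.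
have s0 : 0 < s by rewrite divr_gt0 // mulr_gt0.
have h : 0 < s * a%:R / 4 by rewrite divr_gt0 // mulr_gt0.
have -> : 16 * k%:R ^+ 2 / a%:R ^+ 3 = s^-1 * (s * a%:R / 4)^-1.
  by rewrite /s; field; rewrite !lt0r_neq0.
apply: ler_wpM2l; first by rewrite invr_ge0 ltW.
by apply: le_trans (expRN_le h); rewrite ler_expR.
Qed.

(** The inequality [s * (k - c) <= (1 + s) ^+ (k - c)] bounds the expected deficit itself, not only
    its probability, by an exponential moment of the count [c]. *)
Lemma EW_deficit : (a <= 2 * k)%N ->
  EW (unif R n.+1) (n.+1 * (k + a)) (fun w => (k - count_mem i w)%:R) <=
  16 * k%:R ^+ 2 / a%:R ^+ 3.
Proof.
move=> ak; have k0 : (0 < k)%N by move: a0 ak; case: (k) => //; case: (a).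
have aR : 0 < a%:R :> R by rewrite ltr0n.
have kR : 0 < k%:R :> R by rewrite ltr0n.
have s0 : 0 < s by rewrite divr_gt0 // mulr_gt0.
have s1 : s <= 1 by rewrite ler_pdivrMr ?mulr_gt0 // mul1r -natrM ler_nat.
have sk : s * k%:R = a%:R / 2 by rewrite /s; field; rewrite lt0r_neq0.
have s10 : 0 < 1 + s by lra.
have lu := unif_law R n; set z := (1 + s)^-1.
have z0 : 0 < z by rewrite invr_gt0.
apply: (@le_trans _ _ (s^-1 * ((1 + s) ^+ k * expR ((k + a)%:R * (z - 1))))).
  apply: (@le_trans _ _ (EW (unif R n.+1) (n.+1 * (k + a))
    (fun w => s^-1 * ((1 + s) ^+ k * z ^+ count_mem i w)))).
    apply: (EW_le lu) => w; rewrite mulrC ler_pdivlMr //.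
    case: (leqP (count_mem i w) k) => h; last first.
      have -> : (k - count_mem i w = 0)%N by apply/eqP; rewrite subn_eq0 ltnW.
      by rewrite mul0r mulr_ge0 // exprn_ge0 // ltW.
    rewrite -{2}(subnK h) exprD -mulrA /z exprVn mulfV ?mulr1; last first.
      by rewrite expf_neq0 // lt0r_neq0.
    by apply: le_trans (bernoulli _ (ltW s0)); rewrite lerDr.
  rewrite !EWZ; apply: ler_wpM2l; first by rewrite invr_ge0 ltW.
  apply: ler_wpM2l; first by rewrite exprn_ge0 // ltW.
  exact: EW_count_moment.
apply: (@le_trans _ _ (s^-1 * expR (k%:R * s + (k + a)%:R * (z - 1)))).
  apply: ler_wpM2l; first by rewrite invr_ge0 ltW.
  rewrite expRD; apply: ler_wpM2r; first exact: expR_ge0.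
  rewrite expRM_natl; apply: lerXn2r; rewrite ?nnegrE ?expR_ge0 ?expR_ge1Dx //.
  exact: ltW.
apply: tail => //.
have -> : k%:R * s + (k + a)%:R * (z - 1) = - (s * a%:R / 2 * z).
  have -> : z - 1 = - (s * z) by rewrite /z; field; rewrite lt0r_neq0.
  have zE : (1 + s) * z = 1 by rewrite mulfV // lt0r_neq0.
  rewrite natrD (_ : k%:R * s = k%:R * s * ((1 + s) * z)); last by rewrite zE mulr1.
  have -> : k%:R * s * ((1 + s) * z) + (k%:R + a%:R) * - (s * z) =
     s * z * (s * k%:R - a%:R) by ring.
  by rewrite sk; field.
have z2 : 1 / 2 <= z by rewrite div1r lef_pV2 ?posrE //; lra.
rewrite lerN2; have sa : 0 <= s * a%:R / 2 by rewrite divr_ge0 // mulr_ge0 // ltW.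
by have := ler_wpM2l sa z2; lra.
Qed.

Lemma EW_excess : (a <= k)%N ->
  EW (unif R n.+1) (n.+1 * (k - a)) (fun w => (count_mem i w - k)%:R) <=
  16 * k%:R ^+ 2 / a%:R ^+ 3.
Proof.
move=> ak; have k0 : (0 < k)%N by apply: leq_trans ak.
have aR : 0 < a%:R :> R by rewrite ltr0n.
have kR : 0 < k%:R :> R by rewrite ltr0n.
have akR : a%:R <= k%:R :> R by rewrite ler_nat.
have s0 : 0 < s by rewrite divr_gt0 // mulr_gt0.
have s1 : s <= 1 / 2 by rewrite ler_pdivrMr ?mulr_gt0 //; lra.
have sk : s * k%:R = a%:R / 2 by rewrite /s; field; rewrite lt0r_neq0.
have s10 : 0 < 1 - s by lra.
have lu := unif_law R n; set z := (1 - s)^-1.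
have z0 : 0 < z by rewrite invr_gt0.
have z1 : 1 <= z by rewrite -invr1 lef_pV2 ?posrE //; lra.
have zE : z - 1 = s * z by rewrite /z; field; rewrite lt0r_neq0.
have zs : s <= z - 1 by rewrite zE ler_peMr // ltW.
apply: (@le_trans _ _ (s^-1 * ((1 - s) ^+ k * expR ((k - a)%:R * (z - 1))))).
  apply: (@le_trans _ _ (EW (unif R n.+1) (n.+1 * (k - a))
    (fun w => s^-1 * ((1 - s) ^+ k * z ^+ count_mem i w)))).
    apply: (EW_le lu) => w; rewrite mulrC ler_pdivlMr //.
    case: (leqP k (count_mem i w)) => h; last first.
      have -> : (count_mem i w - k = 0)%N by apply/eqP; rewrite subn_eq0 ltnW.
      by rewrite mul0r mulr_ge0 // exprn_ge0 // ltW.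
    rewrite -{2}(subnK h) exprD [(1 - s) ^+ k * _]mulrCA /z [(1 - s)^-1 ^+ k]exprVn mulfV ?mulr1; last first.
      by rewrite expf_neq0 // lt0r_neq0.
    rewrite -/z (_ : z = 1 + (z - 1)); last by ring.
    apply: le_trans (bernoulli _ _); last by rewrite subr_ge0.
    have := ler_wpM2l (_ : 0 <= (count_mem i w - k)%:R) zs; rewrite ler0n => /(_ isT).
    lra.
  rewrite !EWZ; apply: ler_wpM2l; first by rewrite invr_ge0 ltW.
  apply: ler_wpM2l; first by rewrite exprn_ge0 // ltW.
  exact: EW_count_moment.
apply: (@le_trans _ _ (s^-1 * expR (k%:R * - s + (k - a)%:R * (z - 1)))).
  apply: ler_wpM2l; first by rewrite invr_ge0 ltW.
  rewrite expRD; apply: ler_wpM2r; first exact: expR_ge0.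
  rewrite expRM_natl; apply: lerXn2r; rewrite ?nnegrE ?expR_ge0 ?expR_ge1Dx //.
  exact: ltW.
apply: tail => //.
have -> : k%:R * - s + (k - a)%:R * (z - 1) = - (s * a%:R / 2 * z).
  have zE2 : (1 - s) * z = 1 by rewrite mulfV // lt0r_neq0.
  rewrite zE natrB // (_ : k%:R * - s = k%:R * - s * ((1 - s) * z)); last by rewrite zE2 mulr1.
  have -> : k%:R * - s * ((1 - s) * z) + (k%:R - a%:R) * (s * z) =
     s * z * (s * k%:R - a%:R) by ring.
  by rewrite sk; field.
rewrite lerN2; have sa : 0 <= s * a%:R / 2 by rewrite divr_ge0 // mulr_ge0 // ltW.
by have := ler_wpM2l sa z1; lra.
Qed.

End Tail.

Lemma mean_lnds_upper n k a : (0 < a)%N -> (a <= 2 * k)%N ->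
  mean_lnds R k n.+1 <= word_mean R n.+1 (n.+1 * (k + a)) +
    n.+1%:R * (16 * k%:R ^+ 2 / a%:R ^+ 3).
Proof.
move=> a0 ak; have k0 : (0 < k)%N by move: a0 ak; case: (k) => //; case: (a).
apply: le_trans (mean_lnds_le R n (n.+1 * (k + a)) k0) _; rewrite lerD2l.
have -> : n.+1%:R * (16 * k%:R ^+ 2 / a%:R ^+ 3) =
    \sum_(i <- iota 0 n.+1) (16 * k%:R ^+ 2 / a%:R ^+ 3) :> R.
  by rewrite big_const_seq count_predT size_iota iter_addr addr0 mulr_natl.
rewrite big_seq [leRHS]big_seq; apply: ler_sum => i; rewrite mem_iota add0n => /andP[_ hi].
exact: EW_deficit.
Qed.

Lemma mean_lnds_lower n k a : (0 < a)%N -> (a <= k)%N ->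
  word_mean R n.+1 (n.+1 * (k - a)) - n.+1%:R * (16 * k%:R ^+ 2 / a%:R ^+ 3) <=
  mean_lnds R k n.+1.
Proof.
move=> a0 ak; have k0 : (0 < k)%N by apply: leq_trans ak.
rewrite lerBlDr; apply: le_trans (mean_lnds_ge R n (n.+1 * (k - a)) k0) _; rewrite lerD2l.
have -> : n.+1%:R * (16 * k%:R ^+ 2 / a%:R ^+ 3) =
    \sum_(i <- iota 0 n.+1) (16 * k%:R ^+ 2 / a%:R ^+ 3) :> R.
  by rewrite big_const_seq count_predT size_iota iter_addr addr0 mulr_natl.
rewrite big_seq [leRHS]big_seq; apply: ler_sum => i; rewrite mem_iota add0n => /andP[_ hi].
exact: EW_excess.
Qed.

End Chernoff.

(** * Large and small multiplicities, and the limit *)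

Section Assembly.
Variable R : realType.
Implicit Types (e kap : R).

Definition gm (n k : nat) : R := Num.sqrt (n * k)%:R.

Lemma gm_above (x : R) : exists N0 : nat, forall n k, (N0 <= n)%N -> (0 < k)%N ->
  x <= gm n.+1 k.
Proof.
have [N0 h] := sqrt_above x; exists N0 => n k hn k0; apply: h.
by apply: leq_trans (leq_pmulr _ k0); apply: leqW.
Qed.

Lemma gm_sqr n k : gm n k ^+ 2 = n%:R * k%:R.
Proof. by rewrite sqr_sqrtr // natrM. Qed.

(** With [S = gm n.+1 k], the gap [a] is of order [h * S]: small against [S] and, as [kap * S <= k],
    against [k]. Since [S ^+ 2 = n.+1 * k], the total miscount is nevertheless of order [S / n] for
    fixed [h], hence the threshold [128 / (e * h ^+ 3)] on [n]. *)
Lemma count_gap e kap : 0 < e -> e <= 1 -> 0 < kap -> kap <= 1 ->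
  exists N0 : nat, forall n k, (N0 <= n)%N -> (0 < k)%N -> kap * gm n.+1 k <= k%:R ->
  exists a : nat, [/\ (0 < a)%N, a%:R <= e / 8 * gm n.+1 k, a%:R <= e / 8 * k%:R
    & n.+1%:R * (16 * k%:R ^+ 2 / a%:R ^+ 3) <= e / 8 * gm n.+1 k].
Proof.
move=> e0 e1 q0 q1; pose h : R := kap * e / 16.
have h0 : 0 < h by rewrite divr_gt0 // mulr_gt0.
have [A hA] := gm_above (h^-1).
have [B hB] := nat_above (128 / (e * h ^+ 3)).
exists (A + B)%N => n k hn k0 hk.
have SA : h^-1 <= gm n.+1 k by apply: hA => //; apply: leq_trans hn; apply: leq_addr.
have nB : 128 / (e * h ^+ 3) <= n.+1%:R.
  by apply/hB/leqW; apply: leq_trans hn; apply: leq_addl.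
have S2 := gm_sqr n.+1 k.
have S0 : 0 < gm n.+1 k by apply: lt_le_trans SA; rewrite invr_gt0.
set S := gm n.+1 k in hk SA S2 S0 *.
set a := (Num.truncn (h * S)).+1; exists a.
have a1 : h * S < a%:R by rewrite /a truncnS_gt.
have hS0 : 0 < h * S by rewrite mulr_gt0.
have a2 : a%:R <= h * S + 1 by rewrite /a -natr1 lerD2r truncn_le // ltW.
have hS1 : 1 <= h * S by rewrite -ler_pdivrMl // mulr1.
have a3 : a%:R <= 2 * (h * S) by lra.
have hE : h = kap * e / 16 by [].
split=> //.
- apply: le_trans a3 _; have -> : 2 * (h * S) = kap * (e / 8 * S) by rewrite hE; field.
  by apply: ler_piMl => //; rewrite mulr_ge0 // ltW // divr_gt0.
- apply: le_trans a3 _; have -> : 2 * (h * S) = e / 8 * (kap * S) by rewrite hE; field.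
  by apply: ler_wpM2l => //; rewrite ltW // divr_gt0.
have aR : 0 < a%:R :> R by rewrite ltr0n.
rewrite mulrA ler_pdivrMr ?exprn_gt0 //.
have a4 : (h * S) ^+ 3 <= a%:R ^+ 3 by apply: lerXn2r; rewrite ?nnegrE ?ltW.
have eS : 0 <= e / 8 * S by rewrite mulr_ge0 ?ltW // divr_gt0.
apply: le_trans (ler_wpM2l eS a4).
have -> : e / 8 * S * (h * S) ^+ 3 = e * h ^+ 3 / 8 * (S ^+ 2) ^+ 2 by field.
rewrite S2; have h3 : 0 < e * h ^+ 3 by rewrite mulr_gt0 // exprn_gt0.
rewrite ler_pdivrMr // in nB.
have nn : 0 <= n.+1%:R * k%:R ^+ 2 :> R by rewrite mulr_ge0 // sqr_ge0.
have := ler_wpM2r nn nB; move: (n.+1%:R) (k%:R) (e * h ^+ 3) => u v w; clear.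
by rewrite exprMn; nra.
Qed.

Lemma large_rows_upper e kap : 0 < e -> e <= 1 -> 0 < kap -> kap <= 1 ->
  exists N0 : nat, forall n k, (N0 <= n)%N -> (0 < k)%N -> kap * gm n.+1 k <= k%:R ->
  mean_lnds R k n.+1 <= k%:R + (2 + e) * gm n.+1 k.
Proof.
move=> e0 e1 q0 q1; have [A hA] := count_gap e0 e1 q0 q1.
have e8 : 0 < e / 8 by rewrite divr_gt0.
have [B hB] := word_mean_asym e8.
exists (A + B)%N => n k hn k0 hk.
have [|a [a0 aS ak err]] := hA n k _ k0 hk; first by apply: leq_trans hn; apply: leq_addr.
have nB : (B <= n)%N by apply: leq_trans hn; apply: leq_addl.
have kR : 0 < k%:R :> R by rewrite ltr0n.
have ak2 : a%:R <= k%:R :> R.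
  by apply: le_trans ak _; apply: ler_piMl; rewrite ?ltW //; lra.
have {}ak2 : (a <= 2 * k)%N.
  by rewrite ler_nat in ak2; apply: leq_trans ak2 _; apply: leq_pmull.
have := mean_lnds_upper R n a0 ak2.
have TB : (B <= n.+1 * (k + a))%N.
  apply: leq_trans (leqW nB) (leq_pmulr _ _); rewrite addn_gt0 k0 //.
have := hB n _ nB TB; rewrite ler_norml => /andP[_].
have n0 : n.+1%:R != 0 :> R by rewrite pnatr_eq0.
have -> : (n.+1 * (k + a))%:R / n.+1%:R = k%:R + a%:R :> R.
  by rewrite natrM mulrAC mulfV // mul1r natrD.
have S0 : 0 <= gm n.+1 k by apply: sqrtr_ge0.
have rt : Num.sqrt (n.+1 * (k + a))%:R <= gm n.+1 k * (1 + e / 8).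
  have p0 : 0 <= gm n.+1 k * (1 + e / 8) by apply: mulr_ge0 => //; lra.
  rewrite -[leRHS]ger0_norm // -sqrtr_sqr; apply: ler_wsqrtr.
  rewrite exprMn gm_sqr natrM natrD -mulrA; apply: ler_wpM2l => //.
  have h1 : 0 <= k%:R * (e / 8) by rewrite mulr_ge0 // ltW.
  have h2 : 0 <= k%:R * (e / 8) ^+ 2 by rewrite mulr_ge0 ?sqr_ge0.
  by move: ak; move: (a%:R) => v; clear -h1 h2; lra.
have e2 : 0 <= 2 + e / 8 by lra.
have := ler_wpM2l e2 rt.
have := ler_wpM2r S0 e1; rewrite -(ler_pM2l e0).
move: aS err S0; set S := gm n.+1 k; set er := n.+1%:R * _; set T := Num.sqrt _.
move: (mean_lnds _ _ _) (word_mean _ _ _) (a%:R) (k%:R) er T => v1 v2 v3 v4 v5 v6.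
clear -e0; move=> *; have : 0 <= e * S by rewrite mulr_ge0 // ltW.
by lra.
Qed.

Lemma large_rows_lower e kap : 0 < e -> e <= 1 -> 0 < kap -> kap <= 1 ->
  exists N0 : nat, forall n k, (N0 <= n)%N -> (0 < k)%N -> kap * gm n.+1 k <= k%:R ->
  k%:R + (2 - e) * gm n.+1 k <= mean_lnds R k n.+1.
Proof.
move=> e0 e1 q0 q1; have [A hA] := count_gap e0 e1 q0 q1.
have e8 : 0 < e / 8 by rewrite divr_gt0.
have [B hB] := word_mean_asym e8.
exists (A + B)%N => n k hn k0 hk.
have [|a [a0 aS ak err]] := hA n k _ k0 hk; first by apply: leq_trans hn; apply: leq_addr.
have nB : (B <= n)%N by apply: leq_trans hn; apply: leq_addl.
have kR : 0 < k%:R :> R by rewrite ltr0n.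
have ak1 : (a < k)%N.
  by rewrite -(ltr_nat R); apply: le_lt_trans ak _; rewrite gtr_pMl //; lra.
have := mean_lnds_lower R n a0 (ltnW ak1).
have TB : (B <= n.+1 * (k - a))%N.
  by apply: leq_trans (leqW nB) (leq_pmulr _ _); rewrite subn_gt0.
have := hB n _ nB TB; rewrite ler_norml => /andP[+ _].
have n0 : n.+1%:R != 0 :> R by rewrite pnatr_eq0.
have -> : (n.+1 * (k - a))%:R / n.+1%:R = k%:R - a%:R :> R.
  by rewrite natrM mulrAC mulfV // mul1r natrB // ltnW.
have S0 : 0 <= gm n.+1 k by apply: sqrtr_ge0.
have rt : gm n.+1 k * (1 - e / 8) <= Num.sqrt (n.+1 * (k - a))%:R.
  have p0 : 0 <= gm n.+1 k * (1 - e / 8) by apply: mulr_ge0 => //; lra.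
  rewrite -[leLHS]ger0_norm // -sqrtr_sqr; apply: ler_wsqrtr.
  rewrite exprMn gm_sqr natrM natrB ?(ltnW ak1) // -mulrA; apply: ler_wpM2l => //.
  have h1 : k%:R * (1 - e / 8) ^+ 2 <= k%:R * (1 - e / 8).
    by apply: (ler_wpM2l (ltW kR)); rewrite expr2; apply: ler_piMl; lra.
  by move: ak h1; move: (a%:R) => v; clear; lra.
have e2 : 0 <= 2 - e / 8 by lra.
have := ler_wpM2l e2 rt.
have := mulr_ge0 (mulr_ge0 (ltW e0) (ltW e0)) S0.
move: aS err S0; set S := gm n.+1 k; set er := n.+1%:R * _; set T := Num.sqrt _.
move: (mean_lnds _ _ _) (word_mean _ _ _) (a%:R) (k%:R) er T => v1 v2 v3 v4 v5 v6.
clear -e0; move=> *; have : 0 <= e * S by rewrite mulr_ge0 // ltW.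
by lra.
Qed.

Lemma small_rows_lower e : 0 < e -> e <= 1 ->
  exists N0 : nat, forall n k, (N0 <= n)%N -> (0 < k)%N ->
    k%:R <= e / 16 * gm n.+1 k ->
  k%:R + (2 - e) * gm n.+1 k <= mean_lnds R k n.+1.
Proof.
move=> e0 e1; have e8 : 0 < e / 8 by rewrite divr_gt0.
have [B hB] := word_mean_asym e8.
have [A hA] := gm_above (8 / e).
exists (A + B)%N => n k hn k0 hk.
have SA : 8 / e <= gm n.+1 k by apply: hA => //; apply: leq_trans hn; apply: leq_addr.
have nB : (B <= n)%N by apply: leq_trans hn; apply: leq_addl.
(* An alphabet large enough for the repetition error [(k * n.+1) ^ 3 / M.+1] to be at most one. *)
pose M := maxn B ((k * n.+1) ^ 3).
have := mean_lnds_ge_words R n.+1 M k0.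
have TB : (B <= k * n.+1)%N by apply: leq_trans (leqW nB) (leq_pmull _ k0).
have := hB M (k * n.+1)%N (leq_maxl _ _) TB; rewrite ler_norml => /andP[+ _].
have -> : Num.sqrt (k * n.+1)%:R = gm n.+1 k :> R by rewrite /gm mulnC.
have r1 : (k * n.+1)%:R ^+ 3 / M.+1%:R <= 1 :> R.
  by rewrite ler_pdivrMr ?ltr0n // mul1r -natrX ler_nat leqW // leq_maxr.
have r0 : 0 <= (k * n.+1)%:R / M.+1%:R :> R by rewrite divr_ge0.
have s1 : 8 <= e * gm n.+1 k by rewrite mulrC -ler_pdivrMr.
move: r1 r0 s1 hk; move: (_ / _) ((k * n.+1)%:R / _) (gm _ _) (mean_lnds _ _ _) (word_mean _ _ _).
by move=> v1 v2 v3 v4 v5; clear; lra.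
Qed.

(** Letters are merged [j] at a time, with [j * k] between [q * S] and [2 * q * S]. This nearly
    preserves [S] and makes the new multiplicity comparable to [S], as [large_rows_upper] requires,
    while [j * k] itself stays below [e / 8 * S]. *)
Lemma small_rows_upper e : 0 < e -> e <= 1 ->
  exists N0 : nat, forall n k, (N0 <= n)%N -> (0 < k)%N ->
    k%:R <= e / 16 * gm n.+1 k ->
  mean_lnds R k n.+1 <= k%:R + (2 + e) * gm n.+1 k.
Proof.
move=> e0 e1; set q := e / 16; have q0 : 0 < q by rewrite divr_gt0.
have e4 : 0 < e / 4 by rewrite divr_gt0.
have e41 : e / 4 <= 1 by lra.
have q2 : 0 < q / 2 by rewrite divr_gt0.
have q21 : q / 2 <= 1 by rewrite /q; lra.
have [B hB] := large_rows_upper e4 e41 q2 q21.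
have [A hA] := gm_above (6 / e).
have [C hC] := gm_above (2 * B.+1%:R).
exists (A + C)%N => n k hn k0 hk.
have SA : 6 / e <= gm n.+1 k by apply: hA => //; apply: leq_trans hn; apply: leq_addr.
have SC : 2 * B.+1%:R <= gm n.+1 k by apply: hC => //; apply: leq_trans hn; apply: leq_addl.
have S2 := gm_sqr n.+1 k.
set S := gm n.+1 k in hk SA SC S2 *.
have s6 : 6 <= e * S by rewrite mulrC -ler_pdivrMr.
have B1 : 1 <= B.+1%:R :> R by rewrite ler1n.
have S1 : 1 <= S by lra.
have S0 : 0 < S by lra.
have kR : 0 < k%:R :> R by rewrite ltr0n.
have qS : 0 < q * S by rewrite mulr_gt0.
pose j := (Num.truncn (q * S / k%:R)).+1.
have j1 : q * S < j%:R * k%:R by rewrite -ltr_pdivrMr // /j truncnS_gt.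
have j2 : j%:R * k%:R <= 2 * (q * S).
  have : j%:R <= q * S / k%:R + 1.
    by rewrite /j -natr1 lerD2r truncn_le // divr_ge0 // ltW.
  move/(ler_wpM2r (ltW kR)); rewrite mulrDl mul1r divfK ?lt0r_neq0 //.
  by move: hk; clear; lra.
(* The alphabet is enlarged to [j * m.+1] letters so that [j] divides it; this raises [S] by at most
   one. *)
pose m := (n.+1 %/ j)%N.
have mj1 : (n.+1 <= j * m.+1)%N.
  by rewrite mulnC ltnW // ltn_ceil.
have mj2 : (m * j <= n.+1)%N by apply: leq_trunc_div.
have mj1R : n.+1%:R <= j%:R * m.+1%:R :> R by rewrite -natrM ler_nat.
have mj2R : m%:R * j%:R <= n.+1%:R :> R by rewrite -natrM ler_nat.
have jk0 : (0 < j * k)%N by rewrite muln_gt0.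
have mB : (B <= m)%N.
  have h1 : S ^+ 2 <= j%:R * k%:R * m.+1%:R.
    rewrite S2; have := ler_wpM2r (ltW kR) mj1R; clear; lra.
  have h2 := le_trans h1 (ler_wpM2r (ler0n R m.+1) j2).
  have h3 : S <= 2 * q * m.+1%:R.
    by rewrite -(ler_pM2l S0) -expr2; move: h2; clear; lra.
  have h4 : 2 * q * m.+1%:R <= m.+1%:R.
    by apply: ler_piMl => //; rewrite /q; lra.
  rewrite -ltnS -(ler_nat R); move: (le_trans h3 h4) SC B1; clear; lra.
have S'le : gm m.+1 (j * k) <= S + 1.
  have p0 : 0 <= S + 1 by lra.
  rewrite -[leRHS]ger0_norm // -sqrtr_sqr; apply: ler_wsqrtr.
  rewrite natrM -natr1 natrM.
  have := ler_wpM2r (ltW kR) mj2R; rewrite -S2.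
  have : 2 * (q * S) <= 2 * S by rewrite ler_pM2l // ler_piMl ?(ltW S0) // /q; lra.
  by move: j2; clear; lra.
have S'0 : 0 <= gm m.+1 (j * k) by apply: sqrtr_ge0.
have cond : q / 2 * gm m.+1 (j * k) <= (j * k)%:R.
  rewrite natrM; apply: le_trans (ltW j1).
  have := ler_wpM2l (ltW q2) S'le; have := ler_wpM2l (ltW q0) S1; clear; lra.
have := hB m (j * k)%N mB jk0 cond.
have u1 := mean_lnds_mono R k0 mj1.
have u2 := mean_lnds_merge R k j m.+1.
have eS' : e * gm m.+1 (j * k) <= e * (S + 1) by rewrite ler_pM2l.
rewrite natrM; move: u1 u2 j2 S'le S'0 kR s6 (ltW S0) eS'; rewrite /q.
move: (gm _ (_ * _)) (mean_lnds _ _ _) (mean_lnds _ _ _) (mean_lnds _ _ _) (j%:R * k%:R : R) (k%:R : R).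
move=> v1 v2 v3 v4 v5 v6; clear -e0 e1; lra.
Qed.

Lemma mean_lnds_asym e : 0 < e -> e <= 1 ->
  exists N0 : nat, forall n k, (N0 <= n)%N -> (0 < k)%N ->
    `|mean_lnds R k n.+1 - 2 * gm n.+1 k - k%:R| <= e * gm n.+1 k.
Proof.
move=> e0 e1; have q0 : 0 < e / 16 by rewrite divr_gt0.
have q1 : e / 16 <= 1 by lra.
have [A hA] := large_rows_upper e0 e1 q0 q1.
have [B hB] := large_rows_lower e0 e1 q0 q1.
have [C hC] := small_rows_upper e0 e1.
have [D hD] := small_rows_lower e0 e1.
exists (A + B + C + D)%N => n k hn k0.
have [nA nB nC nD] : [/\ A <= n, B <= n, C <= n & D <= n]%N by split; clear -hn; lia.
have up : mean_lnds R k n.+1 <= k%:R + (2 + e) * gm n.+1 k.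
  by have [/ltW|] := ltP k%:R (e / 16 * gm n.+1 k); [exact: hC | exact: hA].
have lo : k%:R + (2 - e) * gm n.+1 k <= mean_lnds R k n.+1.
  by have [/ltW|] := ltP k%:R (e / 16 * gm n.+1 k); [exact: hD | exact: hB].
rewrite ler_norml; move: up lo; move: (mean_lnds _ _ _) (gm _ _) (k%:R) => x y z.
by clear => h1 h2; apply/andP; split; lra.
Qed.

End Assembly.

Import numFieldNormedType.Exports.
Local Open Scope classical_set_scope.

Theorem theorem2 (R : realType) (k : nat -> nat)
  (hk : forall n : nat, (0 < n)%N -> (0 < k n)%N) :
  (fun n : nat =>
     (expected_LNDS R (k n) n
        - 2 * Num.sqrt ((n * k n)%N%:R) - (k n)%:R)
     / Num.sqrt ((n * k n)%N%:R)) @ \oo --> (0 : R).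
Proof.
apply/cvgrPdist_le => e e0.
pose d : R := Num.min e 1.
have d0 : 0 < d by rewrite lt_min e0 ltr01.
have d1 : d <= 1 by rewrite ge_min lexx orbT.
have de : d <= e by rewrite ge_min lexx.
have [N hN] := mean_lnds_asym d0 d1.
exists N.+1 => // -[|n] //= hn.
have k0 := hk n.+1 isT.
rewrite sub0r normrN expected_LNDS_shuffle // normrM normfV.
have S0 : 0 < gm R n.+1 (k n.+1) by rewrite sqrtr_gt0 ltr0n muln_gt0.
rewrite (ger0_norm (sqrtr_ge0 _)) ler_pdivrMr //.
apply: le_trans (hN n (k n.+1) hn k0) _.
by rewrite ler_pM2r.
Qed.
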